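(* Suppose $\phi'(1)=1$ and $\sigma:=\sqrt{\phi''(1)}<+\infty$. Let $\{c_n\}$ be a sequence of positive numbers such that $c_n\to+\infty$ and $c_n=o(n)$ as $n\to\infty$. (1) If the random walk $S$ is right continuous with $\phi$, then for any $x>0$, $$\lim_{n\to+\infty}\frac1{c_n}\ln\mathbb{P}\left(A_n\ge x\,n^{1/2}c_n^{1/2}\right)=-\frac{q^2x^2}{2\sigma^2}.$$ (2) If the random walk $S$ is left continuous with $\phi$, then for any $x>0$, $$\lim_{n\to+\infty}\frac1{c_n}\ln\mathbb{P}\left(A_n\ge x\,n^{1/2}c_n^{1/2}\right)=-\frac{\sigma^2}{8}x^2.$$
   Context: Let $X_1,X_2,\dots$ be i.i.d. integer-valued random variables, $S_0=0$, $S_n=\sum_{i=1}^nX_i$ for $n\ge1$, and $M_n=\max_{0\le m\le n}S_m$ for $n\ge0$. Let $T_0=0$ and $T_n=\inf\{m>T_{n-1}: S_m\ge M_{m-1}\}$ for $n\ge1$ (with $\inf\emptyset=+\infty$), and let $A_n=\sup\{k\ge1: T_k\le n\}$ for $n\ge1$ (with $\sup\emptyset=0$). $A_n$ is the weak record number up to time $n$. Let $q>0$ and $p_n\ge0$ ($n\ge0$) with $q+\sum_{n\ge0}p_n=1$, and let $\phi(s)=q+\sum_{n=0}^\infty p_ns^{n+1}$, $s\in[0,1]$; $\phi'(1)=\sum_{n\ge0}(n+1)p_n$ and $\phi''(1)=\sum_{n\ge0}n(n+1)p_n$ are the left derivatives at $1$. $S$ is right continuous with $\phi$ if $\mathbb{P}(X_i=1)=q$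 and $\mathbb{P}(X_i=-n)=p_n$ for all $n\ge0$. $S$ is left continuous with $\phi$ if $\mathbb{P}(X_i=-1)=q$ and $\mathbb{P}(X_i=n)=p_n$ for all $n\ge0$. *)

(* Defs.v *)
From HB Require Import structures.
From mathcomp Require Import all_boot all_order all_algebra.
From mathcomp Require Import all_classical all_reals all_analysis.

Set Implicit Arguments.
Unset Strict Implicit.
Unset Printing Implicit Defensive.

Import Order.TTheory GRing.Theory Num.Theory.
Import numFieldNormedType.Exports.

Local Open Scope classical_set_scope.
Local Open Scope ring_scope.

(* The discrete sigma-algebra on int, as the library does for nat and bool;
   it makes {RV P >-> int} the type of integer-valued random variables. *)
HB.instance Definition _ := isPointed.Build int 0.
HB.instance Definition _ := @isMeasurable.Build default_measure_display
  int discrete_measurable discrete_measurable0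
  discrete_measurableC discrete_measurableU.

Section iid.
Context {d d' : measure_display} {Omega : measurableType d}
        {E : measurableType d'} {R : realType} (P : probability Omega R).
Implicit Type X : nat -> {RV P >-> E}.

Definition mutually_independent X : Prop :=
  forall (J : seq nat) (B : nat -> set E), uniq J ->
    (forall i, measurable (B i)) ->
    P (\bigcap_(i in [set` J]) (X i @^-1` B i)) =
      (\prod_(i <- J) P (X i @^-1` B i))%E.

Definition identically_distributed X : Prop :=
  forall (i j : nat) (B : set E), measurable B ->
    distribution P (X i) B = distribution P (X j) B.

Definition iid X : Prop := mutually_independent X /\ identically_distributed X.

End iid.

(* Step sequences are indexed from 0: X i is the (i+1)-th step of the walk. *)
Section walk.
Context {Omega : Type} (R : realType).
Implicit Type X : nat -> Omega -> int.

Definition walk X (n : nat) (w : Omega) : int := \sum_(i < n) X i w.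

Definition walk_max X (n : nat) (w : Omega) : int :=
  \big[Num.max/walk X 0 w]_(m < n.+1) walk X m w.

Fixpoint weak_record_time X (n : nat) (w : Omega) : \bar R :=
  if n is k.+1 then
    ereal_inf [set m%:R%:E | m in [set m : nat |
      (weak_record_time X k w < m%:R%:E)%E /\
      walk_max X m.-1 w <= walk X m w]]
  else 0%E.

(* Adjoining 0 implements the convention that the sup of the empty set is 0
   (ereal_sup set0 would be -oo). *)
Definition weak_record_number X (n : nat) (w : Omega) : \bar R :=
  ereal_sup (0%E |` [set k%:R%:E | k in [set k : nat |
    (1 <= k)%N /\ (weak_record_time X k w <= n%:R%:E)%E]]).

End walk.

(* phi(s) = q + \sum_n p_n s^(n+1) is represented by its coefficients q, p.
   Its left derivatives at 1 are given by the termwise formulas, as possibly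
   infinite sums of nonnegative terms. *)
Section phi.
Context {R : realType}.
Implicit Types (q : R) (p : nat -> R).

Definition phi_coefficients q p : Prop :=
  [/\ 0 < q, (forall n, 0 <= p n) &
      (q%:E + \sum_(0 <= n <oo) (p n)%:E = 1)%E].

Definition phi_d1 p : \bar R :=
  (\sum_(0 <= n <oo) (n.+1%:R * p n)%:E)%E.

Definition phi_d2 p : \bar R :=
  (\sum_(0 <= n <oo) (n%:R * n.+1%:R * p n)%:E)%E.

Context {d : measure_display} {Omega : measurableType d}
        (P : probability Omega R).
Implicit Type X : nat -> {RV P >-> int}.

Definition right_continuous_walk q p X : Prop :=
  forall i : nat, P (X i @^-1` [set 1]) = q%:E /\
    forall n : nat, P (X i @^-1` [set - n%:Z]) = (p n)%:E.

Definition left_continuous_walk q p X : Prop :=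
  forall i : nat, P (X i @^-1` [set -1]) = q%:E /\
    forall n : nat, P (X i @^-1` [set n%:Z]) = (p n)%:E.

End phi.

(* Main.v *)
Require Import Defs.
From mathcomp Require Import all_boot all_order all_algebra.
From mathcomp Require Import all_classical all_reals all_analysis.
From mathcomp Require Import ring lra zify.

Set Implicit Arguments.
Unset Strict Implicit.
Unset Printing Implicit Defensive.

Import Order.TTheory GRing.Theory Num.Theory.
Import numFieldNormedType.Exports.
Local Open Scope classical_set_scope.
Local Open Scope ring_scope.

(** Why the theorem holds.

    Put the steps of both walks in the form 1 - K (right continuous) or K - 1
    (left continuous), where K is distributed as the coefficients of phi:
    phi is the generating function of a critical offspring law of variance
    sigma^2.  The drawdown max S - S is a Markov chain on the naturals, and a
    weak record occurs each time a step brings it to 0 or beyond.  At such a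
    time the chain restarts from 0, so the k-th record time T_k is a sum of k
    independent copies of T_1, and { A_n >= k } = { T_k <= n }.  The theorem
    is thus a moderate deviation estimate for the lower tail of a sum of
    positive variables; large values of T_1 cannot contribute to it, which is
    why two moments of the steps suffice for every c_n = o(n).

    Everything rests on the Laplace transform F of T_1 at z = r / phi(r), for
    r = 1 - h with h small.  This parametrization by r makes F explicit:
    - right continuous: 1 - F = q h / phi(r)   (right_transformP);
    - left continuous:  1 - F = (1 - z) / h    (left_transformP), the
      Wiener-Hopf factorization, obtained here from a generating function
      identity in the initial drawdown (gap_lim0).
    The expansion phi(1-h) = 1 - h + (sigma^2/2 + o(1)) h^2 (gen_expansion,
    curvature_cvg) gives ln (1/z) ~ sigma^2 h^2 / 2 and 1 - F ~ kappa h, with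
    kappa = q, respectively kappa = sigma^2 / 2.

    For h = th sqrt(c_n / n) and k ~ x sqrt(n c_n), the bound
    P(T_k <= n) <= z^-n F^k (hit_upper) has exponent
    c_n (sigma^2 th^2 / 2 - kappa x th), smallest at th = kappa x / sigma^2,
    with value - c_n (kappa x)^2 / (2 sigma^2).  For the matching lower bound,
    the part of E[z^T_k] carried by T_k > n, respectively by T_k < (1-t) n, is
    controlled by the same transform at a slightly larger, respectively
    smaller, z.  All three terms are transforms of the same kind, so no
    change of measure and no derivative of F is needed (hit_lower,
    log_asymptotics).

    The bounds never mention T_k on the probability space: the probability
    that k records occur within n steps satisfies a backward recursion
    (prob_state), along which both bounds propagate by induction on n, since
    z^T_k is turned into a function of the state that the chain preserves up
    to the factor z (record_transform). *)

(** * Averages over the offspring law, and chains driven by independent steps *)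

Section Mean.
Context {R : realType}.
Implicit Types (pi : nat -> R) (f g : nat -> \bar R).

(** Extended reals make every rearrangement below a matter of nonnegativity. *)
Definition mean pi f : \bar R := (\sum_(0 <= k <oo) (pi k)%:E * f k)%E.

Variable pi : nat -> R.
Hypothesis pi_ge0 : forall k, 0 <= pi k.

Lemma mean_ge0 f : (forall k, 0 <= f k)%E -> (0 <= mean pi f)%E.
Proof.
by move=> f0; apply: nneseries_ge0 => k _ _; apply: mule_ge0; rewrite ?lee_fin.
Qed.

Lemma le_mean f g : (forall k, 0 <= f k)%E -> (forall k, f k <= g k)%E ->
  (mean pi f <= mean pi g)%E.
Proof.
move=> f0 fg; apply: lee_nneseries => k _.
  by move=> _; apply: mule_ge0; rewrite ?lee_fin.
by apply: lee_wpmul2l; rewrite ?lee_fin.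
Qed.

Lemma meanD f g : (forall k, 0 <= f k)%E -> (forall k, 0 <= g k)%E ->
  mean pi (fun k => f k + g k)%E = (mean pi f + mean pi g)%E.
Proof.
move=> f0 g0; rewrite /mean -nneseriesD => [||k _ _]; last 2 first.
- by move=> k _ _; apply: mule_ge0; rewrite ?lee_fin.
- by apply: mule_ge0; rewrite ?lee_fin.
by apply: eq_eseriesr => k _; rewrite ge0_muleDr.
Qed.

Lemma meanZ (c : R) f : 0 <= c -> (forall k, 0 <= f k)%E ->
  mean pi (fun k => c%:E * f k)%E = (c%:E * mean pi f)%E.
Proof.
move=> c0 f0; rewrite /mean -nneseriesZl => [|k _].
  by apply: eq_eseriesr => k _; rewrite muleCA.
by apply: mule_ge0; rewrite ?lee_fin.
Qed.

Lemma eq_mean f g : f =1 g -> mean pi f = mean pi g.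
Proof. by move=> fg; apply: eq_eseriesr => k _; rewrite fg. Qed.

Lemma mean_recl f : (forall k, 0 <= f k)%E ->
  (mean pi f = (pi 0%N)%:E * f 0%N + \sum_(0 <= k <oo) (pi k.+1)%:E * f k.+1)%E.
Proof.
move=> f0; rewrite /mean (nneseries_split 0%N 1%N) => [|k _]; last first.
  by apply: mule_ge0; rewrite ?lee_fin.
rewrite big_nat1 add0n; congr (_ + _)%E.
rewrite -(@nneseries_addn _ _ 1%N) => [|k]; last first.
  by apply: mule_ge0; rewrite ?lee_fin.
by apply: eq_eseriesr => k _; rewrite addn1.
Qed.

End Mean.

Section Chain.
Context {R : realType} {S : Type} (step : S -> int -> S) (B : S -> bool).

Fixpoint state (s : S) (x : nat -> int) (n : nat) : S :=
  if n is m.+1 then step (state s x m) (x m) else s.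

(** Backward recursion for the probability that the chain started at s is in B
    after n steps, when each step is v k with probability pi k. *)
Fixpoint hit (pi : nat -> R) (v : nat -> int) (n : nat) (s : S) : \bar R :=
  if n is m.+1 then mean pi (fun k => hit pi v m (step s (v k)))
  else ((B s)%:R : R)%:E.

Lemma eq_state s x y n : (forall i, (i < n)%N -> x i = y i) ->
  state s x n = state s y n.
Proof.
elim: n => //= n IH xy; rewrite IH ?xy// => i ilt; apply: xy.
exact: (ltn_trans ilt).
Qed.

Lemma hit_ge0 pi v n s : (forall k, 0 <= pi k) -> (0 <= hit pi v n s)%E.
Proof.
move=> pi0; elim: n s => [|n IH] s /=; first by rewrite lee_fin ler0n.
exact: mean_ge0.
Qed.

End Chain.

Section ChainProbability.
Context {R : realType} {d : measure_display} {Omega : measurableType d}.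
Variables (P : probability Omega R) (X : nat -> {RV P >-> int}).
Variables (pi : nat -> R) (v : nat -> int).
Hypothesis indX : mutually_independent X.
Hypothesis v_inj : injective v.
Hypothesis lawX : forall i k, P (X i @^-1` [set v k]) = (pi k)%:E.
Hypothesis pi_ge0 : forall k, 0 <= pi k.
Hypothesis pi_sum : (\sum_(0 <= k <oo) (pi k)%:E = 1)%E.
Context {S : Type} (step : S -> int -> S) (B : S -> bool).

Let value_measurable i (A : set int) : measurable (X i @^-1` A).
Proof. by rewrite -[_ @^-1` _]setTI; apply: measurable_funP. Qed.

(** The steps take countably many values, so splitting on the last one
    reduces to earlier times; no sigma-algebra on S is involved. *)
Lemma measurable_state s n (A : set S) :
  measurable [set w | A (state step s (X ^~ w) n)].
Proof.
elim: n A => [|n IH] A /=.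
  have [As|nAs] := pselect (A s).
    by rewrite (_ : [set _ | _] = setT)//; apply/seteqP; split.
  by rewrite (_ : [set _ | _] = set0)//; apply/seteqP; split.
rewrite (_ : [set _ | _] = \bigcup_(z : int) ((X n @^-1` [set z]) `&`
    [set w | A (step (state step s (X ^~ w) n) z)])).
  apply: countable_bigcupT_measurable => [|z]; first exact: countableP.
  by apply: measurableI => //; apply: (IH (fun s => A (step s z))).
apply/seteqP; split => w /=; first by move=> Aw; exists (X n w).
by case=> z _ [/= ->].
Qed.

Definition cylinder (a : nat -> int) m :=
  [set w | forall i, (i < m)%N -> X i w = a i].

Lemma measurable_cylinder a m : measurable (cylinder a m).
Proof.
rewrite (_ : cylinder a m = \bigcap_(i in `I_m) (X i @^-1` [set a i])).
  exact: fin_bigcap_measurable.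
by apply/seteqP; split => w /= H i; apply: H.
Qed.

Lemma cylinderS a m k :
  cylinder (fun i => if i == m then v k else a i) m.+1 =
  cylinder a m `&` (X m @^-1` [set v k]).
Proof.
apply/seteqP; split => w /=.
  move=> H; split => [i ilt|]; last by have := H m (leqnn _); rewrite eqxx.
  by have := H i (ltnW ilt); rewrite (ltn_eqF ilt).
case=> H1 H2 i; rewrite ltnS leq_eqVlt; case: eqP => [-> _|_ /= ilt] //.
exact: H1.
Qed.

Lemma cylinder_prob a m :
  P (cylinder a m) = (\prod_(i <- iota 0 m) P (X i @^-1` [set a i]))%E.
Proof.
rewrite -(@indX (iota 0 m) (fun i => [set a i])) ?iota_uniq//.
congr (P _); apply/seteqP; split => w /= H i.
  by rewrite /= mem_iota add0n => /andP[_]; apply: H.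
by move=> ilt; apply: H; rewrite /= mem_iota.
Qed.

Lemma cylinder_probS a m k :
  P (cylinder (fun i => if i == m then v k else a i) m.+1) =
  (P (cylinder a m) * (pi k)%:E)%E.
Proof.
rewrite !cylinder_prob -addn1 iotaD big_cat /= big_seq1 add0n eqxx lawX.
congr (_ * _)%E; apply: eq_big_seq => i; rewrite mem_iota add0n => /andP[_ ilt].
by rewrite (ltn_eqF ilt).
Qed.

(** The values v k carry the whole law of a step because the pi k sum to 1. *)
Lemma prob_split_step m (A : set Omega) : measurable A ->
  P A = (\sum_(0 <= k <oo) P (A `&` (X m @^-1` [set v k])))%E.
Proof.
move=> mA; pose D := \bigcup_k (X m @^-1` [set v k]).
have tD : trivIset setT (fun k => X m @^-1` [set v k]).
  by move=> i j _ _ [w /= [-> /v_inj]].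
have mD : measurable D by apply: bigcupT_measurable.
have PD : P D = 1%E.
  rewrite measure_semi_bigcup// -[RHS]pi_sum; apply: eq_eseriesr => k _.
  exact: lawX.
have PDC : P (A `\` D) = 0%E.
  apply/eqP; rewrite eq_le measure_ge0 andbT.
  have <- : P (~` D) = 0%E by rewrite probability_setC// PD subee.
  by apply: le_measure; rewrite ?inE; [exact: measurableD|exact: measurableC|move=> w []].
have -> : P A = P (A `&` D).
  by rewrite (measureDI P mA mD) [X in (X + _)%E](_ : _ = 0%E)// add0e.
rewrite /D setI_bigcupr measure_semi_bigcup//.
- by move=> i; apply: measurableI.
- by move=> i j _ _ [w /= [[_ ->] [_ /v_inj]]].
- by apply: bigcupT_measurable => i; apply: measurableI.
Qed.

(** The Markov property in the only form needed: on a cylinder the state at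
    time m is known, and the future is averaged one step at a time.  The
    induction is on the number of remaining steps, with the past prescribed
    arbitrarily. *)
Lemma cylinder_hit s a m n :
  P (cylinder a m `&` [set w | B (state step s (X ^~ w) (m + n)%N)]) =
  (P (cylinder a m) * hit step B pi v n (state step s a m))%E.
Proof.
elim: n a m => [|n IH] a m.
  rewrite addn0 /=; case: (boolP (B _)) => Bs.
    rewrite mule1; congr (P _); apply/seteqP; split => w /= => [[]//|H].
    by split=> //; rewrite (eq_state step s H).
  rewrite mule0 (_ : _ `&` _ = set0) ?measure0//.
  apply/seteqP; split => w //= -[H]; rewrite (eq_state step s H).
  exact/negP.
rewrite (prob_split_step m); last first.
  apply: measurableI; first exact: measurable_cylinder.
  exact: (measurable_state s (m + n.+1)%N (fun s => B s)).
have finP : P (cylinder a m) \is a fin_num.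
  by apply: fin_num_measure; exact: measurable_cylinder.
rewrite /= /mean -(fineK finP) -nneseriesZl; last first.
  by move=> k _; apply: mule_ge0; rewrite ?lee_fin//; exact: hit_ge0.
apply: eq_eseriesr => k _.
rewrite -setIA [X in _ `&` X]setIC setIA -cylinderS addnS -addSn IH.
rewrite cylinder_probS (fineK finP) -muleA /= eqxx; congr (_ * (_ * hit _ _ _ _ _ (step _ _)))%E.
by apply: eq_state => i ilt; rewrite (ltn_eqF ilt).
Qed.

Theorem prob_state s n :
  P [set w | B (state step s (X ^~ w) n)] = hit step B pi v n s.
Proof.
have := cylinder_hit s (fun=> 0) 0%N n.
rewrite add0n (_ : cylinder _ 0 = setT) ?setTI ?probability_setT ?mul1e//.
by apply/seteqP; split.
Qed.

End ChainProbability.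

(** * Weak records as a Markov chain *)

Section Records.
Context {Omega : Type} (R : realType).
Variable X : nat -> Omega -> int.

Definition is_record m w : bool := walk_max X m.-1 w <= walk X m w.

Definition record_count n w : nat := \sum_(1 <= m < n.+1) is_record m w.

Lemma record_count0 w : record_count 0 w = 0%N.
Proof. by rewrite /record_count big_geq. Qed.

Lemma record_countS n w :
  record_count n.+1 w = (record_count n w + is_record n.+1 w)%N.
Proof. by rewrite /record_count big_nat_recr. Qed.

Lemma record_count_mono w : {homo record_count^~ w : m n / (m <= n)%N}.
Proof.
apply: homo_leq => [//|n i j|n]; first exact: leq_trans.
by rewrite record_countS leq_addr.
Qed.

Lemma leq_record_countS k n w : (k < record_count n w)%N <->
  exists m, [/\ (m < n)%N, (k <= record_count m w)%N & is_record m.+1 w].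
Proof.
split=> [|[m [mn km rm]]]; last first.
  apply: leq_trans (record_count_mono w mn).
  by rewrite record_countS rm addn1 ltnS.
elim: n => [|n IH]; first by rewrite record_count0.
rewrite record_countS; case: (boolP (is_record _ _)) => [rn|_].
  by rewrite addn1 ltnS => kn; exists n.
rewrite addn0 => /IH [m [mn km rm]]; exists m; split=> //.
exact: (ltn_trans mn).
Qed.

(** The record times are infima in the extended reals, possibly of the empty
    set; comparing them with naturals brings them back to counting records.
    The strict comparison is the one that the recursion on k feeds on. *)
Lemma weak_record_timeP k w n :
  ((weak_record_time R X k w <= n%:R%:E)%E <-> (k <= record_count n w)%N) /\
  ((weak_record_time R X k w < n%:R%:E)%E <->
     exists2 m, (m < n)%N & (k <= record_count m w)%N).
Proof.
elim: k n => [|k IH] n /=.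
  split; first by rewrite lee_fin ler0n.
  by rewrite lte_fin ltr0n; split=> [n0|[m mn _]]; [exists 0%N|exact: leq_ltn_trans mn].
set A := [set _ | _ in _].
have memA m : A m%:R%:E <-> exists j, m = j.+1 /\
    (k <= record_count j w)%N /\ is_record j.+1 w.
  split=> [[m' /= [lt_m rec_m]] [/eqP]|[j [-> [kj rj]]]].
    rewrite eqr_nat => /eqP mm'; move: lt_m rec_m; rewrite mm'.
    move=> /(proj1 (proj2 (IH _))) [j jm kj] rec_m; exists m.-1.
    rewrite (ltn_predK jm); split=> //; split=> //.
    by apply: leq_trans kj _; apply: record_count_mono; rewrite -ltnS (ltn_predK jm).
  by exists j.+1 => //; split=> //; apply/(proj2 (IH _)); exists j.
have memR x : A x -> exists2 m : nat, A m%:R%:E & x = m%:R%:E.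
  by case=> m Am <-; exists m => //; exists m.
have ltP m : (ereal_inf A < m%:R%:E)%E <-> exists2 j, (j < m)%N & A j%:R%:E.
  split=> [/ereal_inf_lt [x /memR [j Aj ->]]|[j jm Aj]].
    by rewrite lte_fin ltr_nat; exists j.
  by apply: le_lt_trans (ereal_inf_lbound Aj) _; rewrite lte_fin ltr_nat.
have countP m : (k < record_count m w)%N <-> exists2 j, (j <= m)%N & A j%:R%:E.
  rewrite leq_record_countS; split=> [[j [jm kj rj]]|[j jm /memA [i [ji [ki ri]]]]].
    by exists j.+1 => //; apply/memA; exists j.
  by exists i; split=> //; rewrite -ji.
split; last first.
  rewrite ltP; split=> [[j jn Aj]|[m mn]].
    by exists j => //; apply/countP; exists j.
  by move=> /countP [j jm Aj]; exists j => //; apply: leq_ltn_trans jm mn.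
rewrite countP; split=> [infn|[j jn Aj]]; last first.
  by apply: le_trans (ereal_inf_lbound Aj) _; rewrite lee_fin ler_nat.
have /ltP [j jn Aj] : (ereal_inf A < n.+1%:R%:E)%E.
  by apply: le_lt_trans infn _; rewrite lte_fin ltr_nat.
by exists j.
Qed.

Lemma weak_record_numberE n w :
  weak_record_number R X n w = (record_count n w)%:R%:E.
Proof.
apply/eqP; rewrite eq_le; apply/andP; split.
  apply: ge_ereal_sup => _ [->|[k /= [k1 /(proj1 (weak_record_timeP k w n)) kn] <-]].
    by rewrite lee_fin ler0n.
  by rewrite lee_fin ler_nat.
apply: ereal_sup_ubound; have [->|] := posnP (record_count n w); first by left.
move=> r0; right; exists (record_count n w) => //=; split=> //.
by apply/(proj1 (weak_record_timeP _ _ _)).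
Qed.

Lemma walkS n w : walk X n.+1 w = walk X n w + X n w.
Proof. by rewrite /walk big_ord_recr. Qed.

Lemma walk_le_max i n w : (i <= n)%N -> walk X i w <= walk_max X n w.
Proof. by rewrite -ltnS => ilt; apply: (le_bigmax_cond _ _ (j := Ordinal ilt)). Qed.

Lemma walk_maxS n w :
  walk_max X n.+1 w = Num.max (walk_max X n w) (walk X n.+1 w).
Proof.
apply/eqP; rewrite eq_le ge_max walk_le_max// andbT; apply/andP; split.
  apply: bigmax_le => [|i _]; first by rewrite le_max walk_le_max.
  have := ltn_ord i; rewrite ltnS leq_eqVlt => /orP[/eqP ->|ilt].
    by rewrite le_max lexx orbT.
  by rewrite le_max walk_le_max.
apply: bigmax_le => [|i _]; first exact: walk_le_max.
by apply: walk_le_max; apply: ltnW.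
Qed.

End Records.

(** A state is the pair (current drawdown, number of records still to be
    made); the second entry is truncated at 0. *)
Definition record_step (s : nat * nat) (x : int) : nat * nat :=
  if s.1%:Z <= x then (0%N, s.2.-1) else (`|s.1%:Z - x|%N, s.2).

Definition no_record_left (s : nat * nat) : bool := s.2 == 0%N.

Lemma state_record (Omega : Type) (X : nat -> Omega -> int) k n w :
  state record_step (0%N, k) (X ^~ w) n =
  (`|(walk_max X n w - walk X n w)%R|%N, (k - record_count X n w)%N).
Proof.
elim: n => [|n IH] /=.
  rewrite record_count0 subn0 /walk_max /walk big_ord_recl !big_ord0.
  by rewrite maxxx.
rewrite IH /record_step /= record_countS /is_record /= walkS walk_maxS walkS.
have dge : walk X n w <= walk_max X n w by exact: walk_le_max.
have dE : (`|(walk_max X n w - walk X n w)%R|%N : int) =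
    walk_max X n w - walk X n w by rewrite gez0_abs ?subr_ge0.
(* A record at time n + 1 means that the step is at least the drawdown. *)
rewrite dE lerBlDl; case: (leP (walk_max X n w)) => rec.
  by rewrite subrr absz0 addn1 subnS.
by rewrite addn0 opprD addrA.
Qed.

Lemma record_eventE (Omega : Type) (R : realType) (X : nat -> Omega -> int)
    n (y : R) : 0 <= y ->
  [set w | (y%:E <= weak_record_number R X n w)%E] =
  [set w | no_record_left (state record_step (0%N, `|Num.ceil y|%N) (X ^~ w) n)].
Proof.
move=> y0; have E w : (y%:E <= weak_record_number R X n w)%E =
    no_record_left (state record_step (0%N, `|Num.ceil y|%N) (X ^~ w) n).
  rewrite weak_record_numberE state_record /no_record_left /= subn_eq0 lee_fin.
  rewrite -lez_nat gez0_abs.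
    by rewrite ceil_le_int.
  by rewrite ceil_ge0 (lt_le_trans _ y0)// ltrN10.
by apply/seteqP; split => w /=; rewrite E.
Qed.

(** * Exponential bounds from record transforms *)

Section Transform.
Context {R : realType} (pi : nat -> R) (v : nat -> int).
Hypothesis pi_ge0 : forall k, 0 <= pi k.
Hypothesis pi_sum : (\sum_(0 <= k <oo) (pi k)%:E = 1)%E.

(** V (d, j) plays the role of E[z^T], for T the time at which j more records
    have been made from drawdown d, with L = 1/z and F the transform of the
    first record time from drawdown 0.  Only the one-step equation and the
    boundary values are needed, so T itself is never introduced. *)
Record record_transform (L F : R) (V : nat * nat -> R) : Prop := {
  transform_ge0 : forall s, 0 <= V s ;
  transform_done : forall d, V (d, 0%N) = 1 ;
  transform_start : forall j, V (0%N, j) = F ^+ j ;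
  transform_mean : forall d j, (L * V (d, j.+1))%:E =
    mean pi (fun k => (V (record_step (d, j.+1) (v k)))%:E) }.

Notation hit := (hit record_step no_record_left pi v).

Lemma mean_cst (c : R) : 0 <= c -> mean pi (fun=> c%:E) = c%:E.
Proof.
move=> c0; transitivity (mean pi (fun=> c%:E * 1)%E).
  by apply: eq_mean => k; rewrite mule1.
rewrite meanZ// /mean (_ : (\sum_(0 <= k <oo) _)%E = 1%E) ?mule1//.
by rewrite -[RHS]pi_sum; apply: eq_eseriesr => k _; rewrite mule1.
Qed.

Lemma record_step_done d x : (record_step (d, 0%N) x).2 = 0%N.
Proof. by rewrite /record_step /=; case: ifP. Qed.

Lemma hit_done n s : s.2 = 0%N -> hit n s = 1%E.
Proof.
elim: n s => [|n IH] [d j] /= ->; first by [].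
transitivity (mean pi (fun=> 1%:E : \bar R)); last by rewrite mean_cst.
by apply: eq_mean => k; rewrite IH// record_step_done.
Qed.

Lemma hit_fin_num n s : hit n s \is a fin_num.
Proof.
rewrite ge0_fin_numE; last exact: hit_ge0.
apply: (@le_lt_trans _ _ 1%E); last exact: ltry.
elim: n s => [|n IH] s /=; first by rewrite lee_fin; case: no_record_left.
rewrite -[leRHS](mean_cst ler01); apply: le_mean => // k; exact: hit_ge0.
Qed.

(** Chernoff's bound P(T <= n) <= L^n E[L^-T], by induction on n. *)
Lemma hit_upper L F V n s : 1 <= L -> record_transform L F V ->
  (hit n s <= (L ^+ n * V s)%:E)%E.
Proof.
move=> L1 tV; have L0 : 0 <= L by exact: le_trans L1.
elim: n s => [|n IH] [d [|j]].
- by rewrite /= (transform_done tV) mulr1.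
- by rewrite /= expr0 mul1r lee_fin (transform_ge0 tV).
- by rewrite hit_done// (transform_done tV) mulr1 lee_fin exprn_ege1.
have L0n : 0 <= L ^+ n by exact: exprn_ge0.
rewrite exprSr -mulrA EFinM (transform_mean tV) -meanZ//; last first.
  by move=> k; rewrite lee_fin (transform_ge0 tV).
by apply: le_mean => // k; exact: hit_ge0.
Qed.

(** Lower bound by three transforms.  In terms of T it is the average of the
    pointwise inequality
      a L^(n-T) <= 1_{T <= n} + a L1^(n-T) + b L2^(n-T),
    which for T > n holds because L1 <= L (here V <= V1), and for T <= n by
    the hypothesis on a and b. *)
Lemma hit_lower L F V L1 F1 V1 L2 F2 V2 (a b : R) n s :
  record_transform L F V -> record_transform L1 F1 V1 ->
  record_transform L2 F2 V2 ->
  0 <= L -> 0 <= L1 -> 0 <= L2 -> 0 <= a -> 0 <= b ->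
  (forall s, V s <= V1 s) ->
  (forall m, a * L ^+ m <= 1 + b * L2 ^+ m) ->
  ((a * L ^+ n * V s)%:E <=
    hit n s + (a * L1 ^+ n * V1 s)%:E + (b * L2 ^+ n * V2 s)%:E)%E.
Proof.
move=> tV tV1 tV2 L0 L10 L20 a0 b0 VV1 ab.
have V0 := transform_ge0 tV; have V10 := transform_ge0 tV1.
have V20 := transform_ge0 tV2.
elim: n s => [|n IH] [d [|j]].
- rewrite /= (transform_done tV) (transform_done tV1) (transform_done tV2) -!EFinD lee_fin !mulr1; lra.
- rewrite /= add0e -EFinD lee_fin !expr0 !mulr1.
  by apply: ler_wpDr; [exact: mulr_ge0|exact: ler_wpM2l].
- rewrite hit_done// (transform_done tV) (transform_done tV1) (transform_done tV2) !mulr1 -!EFinD lee_fin.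
  have := ab n.+1; have := mulr_ge0 a0 (exprn_ge0 n.+1 L10); lra.
have coef0 (c M : R) : 0 <= c -> 0 <= M -> 0 <= c * M ^+ n.
  by move=> c0 M0; rewrite mulr_ge0// exprn_ge0.
have shift (c M : R) (W : nat * nat -> R) : 0 <= c -> 0 <= M -> (forall s, 0 <= W s) ->
    (forall d j, (M * W (d, j.+1))%:E =
       mean pi (fun k => (W (record_step (d, j.+1) (v k)))%:E)) ->
    (c * M ^+ n.+1 * W (d, j.+1))%:E =
    mean pi (fun k => (c * M ^+ n * W (record_step (d, j.+1) (v k)))%:E).
  move=> c0 M0 W0 tW; rewrite exprSr mulrA -mulrA EFinM tW -meanZ//.
    exact: coef0.
  by move=> k; rewrite lee_fin.
rewrite (shift _ _ _ _ _ V0 (transform_mean tV))//.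
rewrite (shift _ _ _ _ _ V10 (transform_mean tV1))//.
rewrite (shift _ _ _ _ _ V20 (transform_mean tV2))//.
have ge0 (c M : R) (W : nat * nat -> R) s : 0 <= c -> 0 <= M -> (forall s, 0 <= W s) ->
    (0 <= (c * M ^+ n * W s : R)%:E)%E.
  by move=> c0 M0 W0; rewrite lee_fin mulr_ge0// coef0.
rewrite /= -meanD//; last 2 first.
- by move=> k; apply: hit_ge0.
- by move=> k; apply: ge0.
rewrite -meanD//; last 2 first.
- by move=> k; apply: adde_ge0; [exact: hit_ge0|exact: ge0].
- by move=> k; apply: ge0.
by apply: le_mean => // k; exact: ge0.
Qed.

End Transform.

(** * The generating function, and the record transform of a right continuous walk *)

Section GeneratingFunction.
Context {R : realType} (pi : nat -> R).
Hypothesis pi_ge0 : forall k, 0 <= pi k.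
Hypothesis pi_sum : (\sum_(0 <= k <oo) (pi k)%:E = 1)%E.

(** The function phi of the offspring law. *)
Definition gen (r : R) : R := fine (mean pi (fun k => (r ^+ k)%:E)).

Lemma mean_bounded (f : nat -> R) : (forall k, 0 <= f k <= 1) ->
  exists2 m, 0 <= m <= 1 & mean pi (fun k => (f k)%:E) = m%:E.
Proof.
move=> f01; have f0 k : (0 <= (f k)%:E)%E by rewrite lee_fin; case/andP: (f01 k).
have : (mean pi (fun k => (f k)%:E) <= 1%:E)%E.
  rewrite -[leRHS](mean_cst pi_ge0 pi_sum)//; apply: le_mean => // k.
  by rewrite lee_fin; case/andP: (f01 k).
have := mean_ge0 pi_ge0 f0.
case: (mean _ _) => // m; rewrite !lee_fin => m0 m1; exists m => //.
by rewrite m0.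
Qed.

Lemma expr_itv01 (r : R) k : 0 <= r <= 1 -> 0 <= r ^+ k <= 1.
Proof. by move=> /andP[r0 r1]; rewrite exprn_ge0//= exprn_ile1. Qed.

Lemma genE r : 0 <= r <= 1 -> mean pi (fun k => (r ^+ k)%:E) = (gen r)%:E.
Proof.
move=> r01; rewrite /gen.
by have [m _ ->] := mean_bounded (fun k => expr_itv01 k r01).
Qed.

Lemma mean_expr_pred r : 0 < r <= 1 ->
  mean pi (fun k => (r ^+ k.-1)%:E) = (pi 0%N + (gen r - pi 0%N) / r)%:E.
Proof.
move=> /andP[r0 r1].
have r01 k : 0 <= r ^+ k <= 1 by apply: expr_itv01; rewrite ltW.
have f0 k : (0 <= (r ^+ k)%:E)%E by rewrite lee_fin; case/andP: (r01 k).
have [m _ mE] := mean_bounded (fun k => r01 k.-1).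
have := genE (introT andP (conj (ltW r0) r1)).
move: mE; rewrite !mean_recl//= !mule1 => mE.
set T := (\sum_(0 <= k <oo) _)%E in mE.
have -> : (\sum_(0 <= k <oo) (pi k.+1)%:E * (r ^+ k.+1)%:E = r%:E * T)%E.
  rewrite /T -nneseriesZl => [|k _]; last first.
    by apply: mule_ge0; [rewrite lee_fin|exact: f0].
  by apply: eq_eseriesr => k _; rewrite muleCA -EFinM exprS.
rewrite mE; case: T mE => // t [<-] [<-]; congr (_%:E).
by field; rewrite gt_eqF.
Qed.

(** A right continuous walk climbs by unit steps, so from drawdown d > 0 it has
    to climb d levels one after the other, and each of them contributes an
    independent factor r; only the start from 0 is special. *)
Definition right_transform (F r : R) (s : nat * nat) : R :=
  if s.2 is j.+1 then (if s.1 == 0%N then F else r ^+ s.1) * F ^+ j else 1.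

(** The equation at d > 0 is r = z phi(r).  At d = 0 a step K = k leads to
    drawdown k - 1 for k >= 1 and makes a record for k = 0 and k = 1, whence
    the average of r^(k.-1) computed in mean_expr_pred. *)
Lemma right_transformP (r : R) : 0 < r < 1 -> r <= gen r ->
  record_transform pi (fun k => 1 - k%:Z) (gen r / r)
    (1 - (1 - r) * (pi 0%N / gen r))
    (right_transform (1 - (1 - r) * (pi 0%N / gen r)) r).
Proof.
move=> /andP[r0 r1] rg; have g0 : 0 < gen r by exact: lt_le_trans rg.
have r01 : 0 < r <= 1 by rewrite r0 ltW.
set F := 1 - _; have gF : gen r / r * F = pi 0%N + (gen r - pi 0%N) / r.
  by rewrite /F; field; rewrite !gt_eqF.
have F0 : 0 <= F.
  rewrite -(pmulr_rge0 _ (divr_gt0 g0 r0)) gF -lee_fin -mean_expr_pred//.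
  by apply: mean_ge0 => // k; rewrite lee_fin exprn_ge0// ltW.
split=> [[d [|j]]|d|[|j]|d j] //=.
- rewrite /right_transform /=; apply: mulr_ge0; last exact: exprn_ge0.
  by case: ifP => // _; apply: exprn_ge0; exact: ltW.
- by rewrite /right_transform /= -exprS.
have Fj0 : 0 <= F ^+ j by rewrite exprn_ge0.
case: d => [|d].
- rewrite /right_transform /= mulrA gF EFinM muleC -mean_expr_pred// -meanZ//; last first.
    by move=> k; rewrite lee_fin exprn_ge0 ?ltW.
  apply: eq_mean => k; rewrite -EFinM; congr (_%:E).
  rewrite /record_step /=; case: ifPn => [k1|k2].
    have -> : k.-1 = 0%N by lia.
    by rewrite expr0 mulr1; case: j {Fj0} => //= j; rewrite -exprS.
  have -> : `|(0 - (1 - k%:Z))%R|%N = k.-1 by lia.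
  by rewrite /= mulrC; case: k k2 => [|[|k]].
rewrite /right_transform /= mulrA.
(* From drawdown d + 1 a step K = k leads to drawdown d + k. *)
have -> : gen r / r * r ^+ d.+1 = r ^+ d * gen r by rewrite exprS; field; rewrite gt_eqF.
rewrite mulrAC EFinM -genE ?ltW ?r0// -meanZ//; last 2 first.
- by rewrite mulr_ge0// exprn_ge0 ?ltW.
- by move=> k; rewrite lee_fin exprn_ge0 ?ltW.
apply: eq_mean => k; rewrite -EFinM; congr (_%:E).
rewrite mulrAC -exprD /record_step /=; case: ifPn => [k1|k2].
  have -> : (d + k = 0)%N by lia.
  by rewrite expr0 mul1r; case: j {Fj0} => //= j; rewrite -exprS.
have -> : `|(d.+1%:Z - (1 - k%:Z))%R|%N = (d + k)%N by lia.
by rewrite /= ifF//; lia.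
Qed.

Lemma right_transform_mono (r r' : R) : 0 < r -> r <= r' -> r' < 1 ->
  r <= gen r -> r' <= gen r' -> gen r' / r' <= gen r / r ->
  forall s, right_transform (1 - (1 - r) * (pi 0%N / gen r)) r s <=
            right_transform (1 - (1 - r') * (pi 0%N / gen r')) r' s.
Proof.
move=> r0 rr' r'1 rg r'g LL'.
have r'0 : 0 < r' by exact: lt_le_trans rr'.
have [r1 r1'] : r < 1 /\ r' <= 1 by split; [exact: le_lt_trans r'1|exact: ltW].
have g0 : 0 < gen r by exact: lt_le_trans rg.
have g'0 : 0 < gen r' by exact: lt_le_trans r'g.
have tr := right_transformP (introT andP (conj r0 r1)) rg.
have tr' := right_transformP (introT andP (conj r'0 r'1)) r'g.
set F := 1 - _ in tr *; set F' := 1 - _ in tr' *.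
have F0 : 0 <= F by have := transform_ge0 tr (0%N, 1%N); rewrite /right_transform /= expr0 mulr1.
have F'0 : 0 <= F' by have := transform_ge0 tr' (0%N, 1%N); rewrite /right_transform /= expr0 mulr1.
have FF' : F <= F'.
  have LF : gen r / r * F = pi 0%N + (gen r - pi 0%N) / r.
    by rewrite /F; field; rewrite !gt_eqF.
  have LF' : gen r' / r' * F' = pi 0%N + (gen r' - pi 0%N) / r'.
    by rewrite /F'; field; rewrite !gt_eqF.
  rewrite -(ler_pM2l (divr_gt0 g'0 r'0)).
  apply: (@le_trans _ _ (gen r / r * F)); first exact: ler_wpM2r.
  have r01 : 0 < r <= 1 by rewrite r0 ltW.
  have r'01 : 0 < r' <= 1 by rewrite r'0.
  rewrite LF LF' -lee_fin -(mean_expr_pred r01) -(mean_expr_pred r'01).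
  apply: le_mean => // k; rewrite lee_fin; first by rewrite exprn_ge0// ltW.
  by rewrite lerXn2r// nnegrE ltW.
case=> d [|j] //=; rewrite /right_transform /=.
apply: ler_pM; rewrite ?exprn_ge0//; last by rewrite lerXn2r.
  by case: ifP; rewrite ?exprn_ge0// ltW.
by case: ifP => // _; rewrite lerXn2r// nnegrE ltW.
Qed.

End GeneratingFunction.

(** * The record transform of a left continuous walk *)

Section Convolution.
Context {R : realType}.

(** Tonelli for series, once the inner sum is extended by zeros. *)
Lemma nneseries_conv (a b : nat -> R) (beta : R) :
  (forall k, 0 <= a k) -> (forall k, 0 <= b k) ->
  (\sum_(0 <= k <oo) (b k)%:E = beta%:E)%E ->
  (\sum_(0 <= d <oo) (\sum_(0 <= k < d.+1) a k * b (d - k)%N)%:E =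
   beta%:E * \sum_(0 <= k <oo) (a k)%:E)%E.
Proof.
move=> a0 b0 bsum.
pose g d k : \bar R := (if (k <= d)%N then a k * b (d - k)%N else 0)%:E.
have g0 d k : (0 <= g d k)%E by rewrite /g lee_fin; case: ifP => // _; exact: mulr_ge0.
transitivity (\sum_(0 <= d <oo) \sum_(0 <= k <oo) g d k)%E.
  apply: eq_eseriesr => d _; rewrite (nneseries_split 0%N d.+1)// add0n.
  rewrite [X in (_ + X)%E]eseries0 => [|k dk _]; last by rewrite /g leqNgt dk.
  rewrite adde0 -sumEFin; apply: eq_big_nat => k /andP[_ kd].
  by rewrite /g -ltnS kd.
rewrite nneseries_interchange// -nneseriesZl; last by move=> k _; rewrite lee_fin.
apply: eq_eseriesr => k _; rewrite (nneseries_split 0%N k)// add0n.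
rewrite big_nat_cond big1 => [|d /andP[/andP[_ dk] _]]; last first.
  by rewrite /g leqNgt dk.
rewrite add0e -nneseries_addn// -bsum [RHS]muleC -nneseriesZl; last first.
  by move=> i _; rewrite lee_fin.
by apply: eq_eseriesr => i _; rewrite /g leq_addl addnK EFinM.
Qed.

Lemma cvg_sum_nat n (f : nat -> nat -> R) (l : nat -> R) :
  (forall k, f m k @[m --> \oo] --> l k) ->
  \sum_(0 <= k < n) f m k @[m --> \oo] --> \sum_(0 <= k < n) l k.
Proof.
move=> fl; elim: n => [|n IH].
  by under eq_fun do rewrite big_geq//; rewrite big_geq//; exact: cvg_cst.
under eq_fun do rewrite big_nat_recr//=.
by rewrite big_nat_recr//=; apply: cvgD.
Qed.

Lemma nneseries_geometric (r : R) : 0 <= r < 1 ->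
  (\sum_(0 <= d <oo) (r ^+ d)%:E = ((1 - r)^-1)%:E)%E.
Proof.
move=> /andP[r0 r1]; apply/cvg_lim => //.
rewrite (_ : (fun n => _) = EFin \o series (geometric 1 r)); last first.
  apply/funext => n /=; rewrite sumEFin /series /=; congr (_%:E).
  by apply: eq_bigr => i _; rewrite /geometric /= mul1r.
rewrite -[X in X%:E]mul1r; apply: cvg_EFin; first by near=> n.
by apply: cvg_geometric_series; rewrite ger0_norm.
Unshelve. all: by end_near. Qed.

End Convolution.

Section LeftTransform.
Context {R : realType} (pi : nat -> R).
Hypothesis pi_ge0 : forall k, 0 <= pi k.
Hypothesis pi_sum : (\sum_(0 <= k <oo) (pi k)%:E = 1)%E.

(** 1 - E[z^T 1_{T <= n}] for the first record time T from drawdown d.  For a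
    left continuous walk a step K = k makes a record exactly when k > d, so
    the complement of the transform satisfies a recursion with finite sums. *)
Fixpoint no_record_gap (z : R) (n d : nat) : R :=
  if n is m.+1 then
    1 - z * (1 - \sum_(0 <= k < d.+1) pi k * no_record_gap z m (d - k).+1)
  else 1.

Notation gap := no_record_gap.

Lemma pi_partial n : \sum_(0 <= k < n) pi k <= 1.
Proof.
rewrite -lee_fin -pi_sum -sumEFin; apply: nneseries_lim_ge => k _.
by rewrite lee_fin.
Qed.

Lemma gap_sum_itv (f : nat -> R) d : (forall i, 0 <= f i <= 1) ->
  0 <= \sum_(0 <= k < d.+1) pi k * f (d - k).+1 <= 1.
Proof.
move=> f01; rewrite sumr_ge0 => [|k _]; last first.
  by rewrite mulr_ge0//; case/andP: (f01 (d - k).+1).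
apply: le_trans (pi_partial d.+1); apply: ler_sum => k _.
by rewrite ler_piMr//; case/andP: (f01 (d - k).+1).
Qed.

Lemma gap_itv z n d : 0 <= z <= 1 -> 0 <= gap z n d <= 1.
Proof.
move=> /andP[z0 z1]; elim: n d => [|n IH] d /=; first by rewrite ler01 lexx.
have /andP[s0 s1] := gap_sum_itv d IH.
set s := \sum_(_ <= _ < _) _ in s0 s1 *.
have : z * (1 - s) <= 1 by rewrite -[leRHS]mulr1; apply: ler_pM; lra.
have : 0 <= z * (1 - s) by rewrite mulr_ge0//; lra.
lra.
Qed.

Lemma gap_antitone z z' n d : 0 <= z -> z <= z' -> z' <= 1 ->
  gap z' n d <= gap z n d.
Proof.
move=> z0 zz' z'1; elim: n d => [//|n IH] d /=.
have z01 : 0 <= z <= 1 by rewrite z0 (le_trans zz').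
have /andP[s0 s1] := gap_sum_itv d (fun i => gap_itv n i z01).
have : \sum_(0 <= k < d.+1) pi k * gap z' n (d - k).+1 <=
       \sum_(0 <= k < d.+1) pi k * gap z n (d - k).+1.
  by apply: ler_sum => k _; apply: ler_wpM2l.
move: s1; set s := \sum_(_ <= _ < _) _; set s' := \sum_(_ <= _ < _) _ => s'1 ss'.
rewrite lerB// ler_pM//; [lra|lra].
Qed.

Lemma gap_decr z n d : 0 <= z <= 1 -> gap z n.+1 d <= gap z n d.
Proof.
move=> z01; elim: n d => [|n IH] d.
  by have /andP[] := gap_itv 1 d z01.
rewrite -[gap _ n.+2 _]/(1 - z * (1 - \sum_(0 <= k < d.+1) pi k * gap z n.+1 (d - k).+1)).
rewrite -[gap _ n.+1 _]/(1 - z * (1 - \sum_(0 <= k < d.+1) pi k * gap z n (d - k).+1)).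
rewrite lerB// ler_wpM2l ?lerB//; first by case/andP: z01.
by apply: ler_sum => k _; apply: ler_wpM2l.
Qed.

Definition gap_lim (z : R) (d : nat) : R := limn (fun n => gap z n d).

Lemma cvg_gap z : 0 <= z <= 1 -> forall d, gap z n d @[n --> \oo] --> gap_lim z d.
Proof.
move=> z01 d; apply: nonincreasing_is_cvgn.
  by apply/nonincreasing_seqP => n; exact: gap_decr.
by exists 0 => _ [n _ <-]; case/andP: (gap_itv n d z01).
Qed.

Lemma gap_lim_itv z : 0 <= z <= 1 -> forall d, 0 <= gap_lim z d <= 1.
Proof.
move=> z01 d; have c := @cvg_gap z z01 d.
apply/andP; split.
  by apply: limr_ge; [apply/cvg_ex; eexists; exact: c|];
    near=> n; case/andP: (gap_itv n d z01).
by apply: limr_le; [apply/cvg_ex; eexists; exact: c|];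
  near=> n; case/andP: (gap_itv n d z01).
Unshelve. all: by end_near. Qed.

Lemma gap_lim_antitone z z' d : 0 <= z -> z <= z' -> z' <= 1 ->
  gap_lim z' d <= gap_lim z d.
Proof.
move=> z0 zz' z'1; apply: ler_lim.
- by apply/cvg_ex; eexists; apply: cvg_gap; rewrite (le_trans z0).
- by apply/cvg_ex; eexists; apply: cvg_gap; rewrite z0 (le_trans zz').
- by near=> n; exact: gap_antitone.
Unshelve. all: by end_near. Qed.

Lemma gap_limE z d : 0 <= z <= 1 ->
  gap_lim z d =
  1 - z * (1 - \sum_(0 <= k < d.+1) pi k * gap_lim z (d - k).+1).
Proof.
move=> z01; have c : gap z n.+1 d @[n --> \oo] --> gap_lim z d.
  by rewrite (cvg_shiftS (fun n => gap z n d)); exact: cvg_gap.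
apply: (cvg_unique _ c) => //=.
apply: cvgB; first exact: cvg_cst.
apply: cvgM; first exact: cvg_cst.
apply: cvgB; first exact: cvg_cst.
apply: cvg_sum_nat => k.
by apply: cvgM; [exact: cvg_cst|exact: cvg_gap].
Qed.

(** Summing the fixed point equation of the gaps against r^(d+1) turns the sum
    over k into the product phi(r) * (sum of r^i gap i, i >= 1).  Since
    z phi(r) = r the unknown sum cancels, and only the gap at 0 remains. *)
Lemma gap_lim0 (r : R) : 0 < r < 1 -> r <= gen pi r ->
  gap_lim (r / gen pi r) 0 = (1 - r / gen pi r) / (1 - r).
Proof.
move=> /andP[r0 r1] rg; have g0 : 0 < gen pi r by exact: lt_le_trans rg.
set z := r / gen pi r.
have z01 : 0 <= z <= 1.
  by rewrite /z divr_ge0 ?(ltW r0) ?(ltW g0)//= ler_pdivrMr// mul1r.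
have /andP[z0 z1] := z01.
have r01 : 0 <= r <= 1 by rewrite (ltW r0) (ltW r1).
(* Shifted by one: a step from d that makes no record ends at d + 1 - k >= 1. *)
pose b i := r ^+ i.+1 * gap_lim z i.+1.
have G01 d := gap_lim_itv z01 d.
have b0 i : 0 <= b i by rewrite mulr_ge0 ?exprn_ge0 ?(ltW r0)//; case/andP: (G01 i.+1).
have geoE : (\sum_(0 <= d <oo) (r ^+ d.+1)%:E = (r / (1 - r))%:E)%E.
  transitivity (r%:E * \sum_(0 <= d <oo) (r ^+ d)%:E)%E.
    rewrite -nneseriesZl => [|k _]; last by rewrite lee_fin exprn_ge0// ltW.
    by apply: eq_eseriesr => d _; rewrite -EFinM exprS.
  by rewrite nneseries_geometric ?r1 ?(ltW r0).
have [beta bsum] : exists beta, (\sum_(0 <= k <oo) (b k)%:E = beta%:E)%E.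
  have : (\sum_(0 <= k <oo) (b k)%:E <= (r / (1 - r))%:E)%E.
    rewrite -geoE; apply: lee_nneseries => k _; first by move=> _; rewrite lee_fin.
    by rewrite lee_fin ler_piMr ?exprn_ge0 ?(ltW r0)//; case/andP: (G01 k.+1).
  have : (0 <= \sum_(0 <= k <oo) (b k)%:E)%E.
    by apply: nneseries_ge0 => k _ _; rewrite lee_fin.
  by case: (\sum_(0 <= k <oo) _)%E => // t _ _; exists t.
have sumL : (\sum_(0 <= d <oo) (r ^+ d.+1 * gap_lim z d)%:E =
    (r * gap_lim z 0)%:E + r%:E * beta%:E)%E.
  rewrite (nneseries_split 0%N 1%N) => [|k _]; last first.
    by rewrite lee_fin mulr_ge0 ?exprn_ge0 ?(ltW r0)//; case/andP: (G01 k).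
  rewrite big_nat1 expr1; congr (_ + _)%E.
  rewrite -(@nneseries_addn _ _ 1%N) => [|k]; last first.
    by rewrite lee_fin mulr_ge0 ?exprn_ge0 ?(ltW r0)//; case/andP: (G01 k).
  rewrite -bsum -nneseriesZl => [|k _]; last by rewrite lee_fin.
  by apply: eq_eseriesr => d _; rewrite addn1 -EFinM /b [in LHS]exprS mulrA.
have gsum : (\sum_(0 <= k <oo) (pi k * r ^+ k)%:E = (gen pi r)%:E)%E.
  by rewrite -genE//; apply: eq_eseriesr => k _; rewrite EFinM.
have a0 k : 0 <= pi k * r ^+ k by rewrite mulr_ge0 ?exprn_ge0 ?(ltW r0).
have sumR : (\sum_(0 <= d <oo) (r ^+ d.+1 * gap_lim z d)%:E =
    ((1 - z) * (r / (1 - r)))%:E + z%:E * (beta%:E * (gen pi r)%:E))%E.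
  rewrite EFinM -geoE -gsum -(nneseries_conv a0 b0 bsum).
  have cv0 d : 0 <= \sum_(0 <= k < d.+1) pi k * r ^+ k * b (d - k)%N.
    by apply: sumr_ge0 => k _; rewrite mulr_ge0.
  have re0 d : 0 <= r ^+ d.+1 by rewrite exprn_ge0 ?(ltW r0).
  rewrite -!nneseriesZl; do ?[by move=> k _; rewrite lee_fin].
  rewrite -nneseriesD; do ?[by move=> k _ _; rewrite -EFinM lee_fin mulr_ge0// subr_ge0].
  apply: eq_eseriesr => d _; rewrite -!EFinM -EFinD; congr (_%:E).
  rewrite [in LHS]gap_limE//.
  have -> : \sum_(0 <= k < d.+1) pi k * r ^+ k * b (d - k)%N =
      r ^+ d.+1 * \sum_(0 <= k < d.+1) pi k * gap_lim z (d - k).+1.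
    rewrite big_distrr; apply: eq_big_nat => k /andP[_ kd].
    have -> : r ^+ d.+1 = r ^+ k * r ^+ (d - k).+1.
      by rewrite -exprD addnS subnKC.
    by rewrite /b /=; ring.
  by ring.
move: sumL; rewrite sumR -!EFinM -!EFinD => -[].
have -> : z * (beta * gen pi r) = r * beta by rewrite /z; field; rewrite gt_eqF.
move=> /addIr E; apply: (mulfI (lt0r_neq0 r0)); rewrite -E.
by ring.
Qed.

Definition left_transform (z : R) (s : nat * nat) : R :=
  if s.2 is j.+1 then (1 - gap_lim z s.1) * (1 - gap_lim z 0) ^+ j else 1.

(** Regeneration at record times: once the first record is made the drawdown
    is 0 and the j further records contribute the factor F^j. *)
Lemma left_transformP (r : R) : 0 < r < 1 -> r <= gen pi r ->
  record_transform pi (fun k => k%:Z - 1) (gen pi r / r)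
    (1 - (1 - r / gen pi r) / (1 - r)) (left_transform (r / gen pi r)).
Proof.
move=> r01 rg; rewrite -gap_lim0//.
have /andP[r0 r1] := r01.
have g0 : 0 < gen pi r by exact: lt_le_trans rg.
set z := r / gen pi r.
have z01 : 0 <= z <= 1.
  by rewrite /z divr_ge0 ?(ltW r0) ?(ltW g0)//= ler_pdivrMr// mul1r.
have G01 d := gap_lim_itv z01 d.
have V0 d : 0 <= 1 - gap_lim z d by rewrite subr_ge0; case/andP: (G01 d).
split=> [[d [|j]]|d|[|j]|d j] //=.
- by rewrite /left_transform /= mulr_ge0// exprn_ge0.
- by rewrite /left_transform /= -exprS.
rewrite {1}/left_transform /=; set Fj := _ ^+ j.
have Fj0 : 0 <= Fj by rewrite exprn_ge0.
pose s := \sum_(0 <= k < d.+1) pi k * gap_lim z (d - k).+1.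
have zL : gen pi r / r * z = 1 by rewrite /z; field; rewrite !gt_eqF.
have -> : gen pi r / r * ((1 - gap_lim z d) * Fj) = Fj * (1 - s).
  rewrite [in LHS]gap_limE// -/s -[RHS]mul1r -zL; ring.
pose h k : R := if (k <= d)%N then gap_lim z (d - k).+1 else 0.
have h0 k : 0 <= h k by rewrite /h; case: ifP => // _; case/andP: (G01 (d - k).+1).
have h1 k : 0 <= 1 - h k by rewrite /h; case: ifP => // _; rewrite subr0.
have hs : mean pi (fun k => (h k)%:E) = s%:E.
  rewrite /mean (nneseries_split 0%N d.+1)//; last by move=> k _; rewrite mule_ge0 ?lee_fin.
  rewrite add0n [X in (_ + X)%E]eseries0 => [|k dk _]; last first.
    by rewrite /h leqNgt dk mule0.
  rewrite adde0 /s -sumEFin; apply: eq_big_nat => k /andP[_ kd].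
  by rewrite /h -ltnS kd EFinM.
have E : mean pi (fun k => (1 - h k)%:E) = (1 - s)%:E.
  have : (mean pi (fun k => (1 - h k)%:E) + s%:E = 1%:E)%E.
    rewrite -hs -meanD//; do ?[by move=> k; rewrite lee_fin].
    rewrite -[RHS](mean_cst pi_ge0 pi_sum)//; apply: eq_mean => k.
    by rewrite -EFinD subrK.
  by case: (mean _ _) => // m [<-]; rewrite addrK.
rewrite EFinM -E -meanZ//.
apply: eq_mean => k; rewrite -EFinM; congr (_%:E).
rewrite /record_step /h /=; case: ifPn => [kd|dk].
  rewrite ifF; last by lia.
  have -> : `|(d%:Z - (k%:Z - 1))%R|%N = (d - k).+1 by lia.
  by rewrite /left_transform /= mulrC.
rewrite ifT; last by lia.
by rewrite subr0 mulr1 /Fj /left_transform /=; case: (j) => //= i; rewrite exprS.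
Qed.

Lemma left_transform_mono (z z' : R) : 0 <= z -> z <= z' -> z' <= 1 ->
  forall s, left_transform z s <= left_transform z' s.
Proof.
move=> z0 zz' z'1; have z1 := le_trans zz' z'1; have z'0 := le_trans z0 zz'.
have G0 d : 0 <= 1 - gap_lim z d.
  by rewrite subr_ge0; have /andP[] := gap_lim_itv (introT andP (conj z0 z1)) d.
have GG d : 1 - gap_lim z d <= 1 - gap_lim z' d by rewrite lerB// gap_lim_antitone.
case=> d [|j] //=; rewrite /left_transform /=.
by apply: ler_pM; rewrite ?exprn_ge0// lerXn2r// nnegrE// (le_trans (G0 0%N)).
Qed.

End LeftTransform.

(** * Second order expansion of the generating function at 1 *)

Section SecondOrder.
Context {R : realType} (pi : nat -> R).
Hypothesis pi_ge0 : forall k, 0 <= pi k.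
Hypothesis pi_sum : (\sum_(0 <= k <oo) (pi k)%:E = 1)%E.
Hypothesis pi_mean : mean pi (fun k => k%:R%:E) = 1%E.
Variable s : R.
Hypothesis pi_var : mean pi (fun k => (k%:R * (k%:R - 1))%:E) = s%:E.

Lemma choose2_ge0 k : 0 <= k%:R * (k%:R - 1) :> R.
Proof. by case: k => [|k]; rewrite ?mul0r// -natr1 addrK mulr_ge0. Qed.

(** The remainder ((1-h)^k - 1 + k h) / h^2, in a form that also makes sense at
    h = 0, where it equals k (k - 1) / 2. *)
Fixpoint taylor_rest (h : R) (k : nat) : R :=
  if k is m.+1 then (1 - h) * taylor_rest h m + m%:R else 0.

Lemma taylor_restE h k : (1 - h) ^+ k = 1 - k%:R * h + h ^+ 2 * taylor_rest h k.
Proof.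
elim: k => [|k IH] /=; first by rewrite expr0; ring.
by rewrite exprS IH -natr1; ring.
Qed.

(** The upper bound allows averaging with a finite second moment only; the
    lower bound differs from it by a factor that is uniformly close to 1 on
    any finite range of k as h tends to 0. *)
Lemma taylor_rest_bounds h k : 0 <= h <= 1 ->
  (1 - h) ^+ k * (k%:R * (k%:R - 1) / 2) <= taylor_rest h k <=
  k%:R * (k%:R - 1) / 2.
Proof.
move=> /andP[h0 h1]; elim: k => [|k /andP[IH1 IH2]] /=.
  by rewrite !mul0r mulr0 lexx.
have h'0 : 0 <= 1 - h by rewrite subr_ge0.
have t0 : 0 <= k%:R * (k%:R - 1) / 2 :> R by rewrite divr_ge0// choose2_ge0.
rewrite -natr1; apply/andP; split.
  apply: (@le_trans _ _ ((1 - h) * ((1 - h) ^+ k * (k%:R * (k%:R - 1) / 2)) +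
     (1 - h) ^+ k.+1 * k%:R)).
    by rewrite exprS le_eqVlt; apply/orP; left; apply/eqP; field.
  apply: lerD; first exact: ler_wpM2l.
  rewrite ler_piMl// exprn_ile1//; lra.
apply: (@le_trans _ _ (k%:R * (k%:R - 1) / 2 + k%:R)); last first.
  by rewrite le_eqVlt; apply/orP; left; apply/eqP; field.
rewrite lerD2r; apply: le_trans (ler_wpM2l h'0 IH2) _.
by rewrite ler_piMl//; lra.
Qed.

Lemma taylor_rest_ge0 h k : 0 <= h <= 1 -> 0 <= taylor_rest h k.
Proof.
move=> h01; have /andP[+ _] := taylor_rest_bounds k h01; apply: le_trans.
case/andP: h01 => h0 h1; rewrite mulr_ge0 ?exprn_ge0 ?subr_ge0//.
by rewrite divr_ge0// choose2_ge0.
Qed.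

Definition curvature (h : R) : R := fine (mean pi (fun k => (taylor_rest h k)%:E)).

Lemma curvatureE h : 0 <= h <= 1 ->
  mean pi (fun k => (taylor_rest h k)%:E) = (curvature h)%:E /\
  0 <= curvature h <= s / 2.
Proof.
move=> h01.
have le : (mean pi (fun k => (taylor_rest h k)%:E) <= (s / 2)%:E)%E.
  rewrite mulrC EFinM -pi_var -meanZ//; last by move=> k; rewrite lee_fin choose2_ge0.
  apply: le_mean => // k; rewrite ?lee_fin ?taylor_rest_ge0//.
  by rewrite mulrC; case/andP: (taylor_rest_bounds k h01).
have ge : (0 <= mean pi (fun k => (taylor_rest h k)%:E))%E.
  by apply: mean_ge0 => // k; rewrite lee_fin taylor_rest_ge0.
rewrite /curvature; move: le ge; case: (mean _ _) => // m.
by rewrite !lee_fin => -> ->.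
Qed.

Lemma gen_expansion h : 0 <= h <= 1 ->
  gen pi (1 - h) = 1 - h + h ^+ 2 * curvature h.
Proof.
move=> h01; have /andP[h0 h1] := h01; have [cE _] := curvatureE h01.
have r01 : 0 <= 1 - h <= 1 by apply/andP; split; lra.
have : (mean pi (fun k => ((1 - h) ^+ k)%:E) + h%:E * mean pi (fun k => k%:R%:E) =
    1%:E + (h ^+ 2)%:E * mean pi (fun k => (taylor_rest h k)%:E))%E.
  rewrite -(mean_cst pi_ge0 pi_sum ler01) -!meanZ ?exprn_ge0//; last first.
    by move=> k; rewrite lee_fin taylor_rest_ge0.
  rewrite -!meanD//.
  - by apply: eq_mean => k; rewrite -!EFinM -!EFinD taylor_restE; congr (_%:E); ring.
  - by move=> k; rewrite -EFinM lee_fin mulr_ge0 ?exprn_ge0// taylor_rest_ge0.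
  - by move=> k; rewrite lee_fin exprn_ge0//; case/andP: r01.
  - by move=> k; rewrite -EFinM lee_fin mulr_ge0.
rewrite genE// pi_mean cE mule1 -EFinM -!EFinD => -[E].
by apply: (@addIr _ h); rewrite E; ring.
Qed.

(** A dominated convergence: the curvature never exceeds s / 2, and truncating
    the offspring law at a large N loses little of s. *)
Lemma curvature_cvg (h : nat -> R) : (forall n, 0 <= h n) ->
  h n @[n --> \oo] --> 0 -> curvature (h n) @[n --> \oo] --> s / 2.
Proof.
move=> h0 hc; apply/cvgrPdist_lt => e e0.
pose S N := \sum_(0 <= k < N) pi k * (k%:R * (k%:R - 1)).
have S_cvg : S N @[N --> \oo] --> s.
  rewrite (_ : S = fine \o (fun N =>
      \sum_(0 <= k < N) (pi k)%:E * (k%:R * (k%:R - 1))%:E)%E); last first.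
    by apply/funext => N /=; have -> // : (\sum_(0 <= k < N)
      (pi k)%:E * (k%:R * (k%:R - 1))%:E = (S N)%:E)%E by rewrite /S -sumEFin.
  apply: fine_cvg; rewrite -pi_var; apply: is_cvg_nneseries => k _ _.
  by rewrite mule_ge0// lee_fin ?choose2_ge0.
have [N SN] : exists N, s - e < S N.
  have /cvgrPdist_lt /(_ _ e0) [N _ /(_ N (leqnn N))] := S_cvg.
  by move=> SN; exists N; have := ler_norm (s - S N); lra.
have lower x : 0 <= x <= 1 -> (1 - x) ^+ N * (S N / 2) <= curvature x.
  move=> x01; have [cE _] := curvatureE x01.
  have /andP[x0 x1] := x01.
  have g0 k : (0 <= (taylor_rest x k)%:E)%E by rewrite lee_fin taylor_rest_ge0.
  rewrite -lee_fin -cE; apply: (@le_trans _ _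
      (\sum_(0 <= k < N) (pi k)%:E * (taylor_rest x k)%:E)%E); last first.
    by apply: nneseries_lim_ge => k _; rewrite mule_ge0// lee_fin.
  have -> : (1 - x) ^+ N * (S N / 2) =
      \sum_(0 <= k < N) pi k * ((1 - x) ^+ N * (k%:R * (k%:R - 1) / 2)).
    by rewrite /S mulrA big_distrr big_distrl /=; apply: eq_bigr => k _; ring.
  rewrite -sumEFin 2!big_nat; apply: lee_sum => k /andP[_ kN].
  rewrite -EFinM lee_fin; apply: ler_wpM2l => //.
  have /andP[tk _] := taylor_rest_bounds k x01; apply: le_trans tk.
  apply: ler_wpM2r; first by rewrite divr_ge0// choose2_ge0.
  apply: ler_wiXn2l; [lra|lra|exact: ltnW].
have xc : (1 - h n) ^+ N * (S N / 2) @[n --> \oo] --> S N / 2.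
  have c1 : 1 - h n @[n --> \oo] --> (1 - 0 : R) by apply: cvgB => //; exact: cvg_cst.
  rewrite subr0 in c1.
  have cN : (1 - h n) ^+ N @[n --> \oo] --> (1 ^+ N : R).
    elim: (N) => [|m IH]; first by rewrite expr0; exact: cvg_cst.
    by rewrite exprS; under eq_fun do rewrite exprS; exact: cvgM.
  have : (1 - h n) ^+ N * (S N / 2) @[n --> \oo] --> 1 ^+ N * (S N / 2).
    by apply: cvgM => //; exact: cvg_cst.
  by rewrite expr1n mul1r.
have e'0 : 0 < e / 2 by rewrite divr_gt0.
have /cvgrPdist_lt /(_ _ e'0) near1 := xc.
have /cvgrPdist_lt /(_ _ ltr01) near2 := hc.
near=> n.
have h01 : 0 <= h n <= 1.
  rewrite h0 /=; have : `|0 - h n| < 1 by near: n.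
  by rewrite sub0r normrN ger0_norm// => /ltW.
have lo := lower _ h01.
have [_ /andP[_ up]] := curvatureE h01.
have : `|S N / 2 - (1 - h n) ^+ N * (S N / 2)| < e / 2 by near: n.
move=> /(le_lt_trans (ler_norm _)) lt1.
rewrite ger0_norm ?subr_ge0//; lra.
Unshelve. all: by end_near. Qed.

End SecondOrder.

(** * Logarithmic asymptotics from exponential bounds *)

Section LogLimits.
Context {R : realType}.

(** Replaces ln (1 + y) by its first order y, by y / (1+y) <= ln (1+y) <= y. *)
Lemma cvg_mul_ln1D (a y : nat -> R) (l : R) :
  (forall n, 0 <= a n) -> y n @[n --> \oo] --> 0 ->
  a n * y n @[n --> \oo] --> l -> a n * ln (1 + y n) @[n --> \oo] --> l.
Proof.
move=> a0 yc ayc.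
have lo : a n * y n / (1 + y n) @[n --> \oo] --> l.
  have : (1 + y n)^-1 @[n --> \oo] --> ((1 + 0)^-1 : R).
    apply: cvgV; first by rewrite addr0.
    by apply: cvgD => //; exact: cvg_cst.
  rewrite addr0 invr1 => c1.
  by rewrite -[l]mulr1; exact: cvgM.
apply: (squeeze_cvgr _ lo ayc); near=> n.
have y1 : - 1 < y n by near: n; apply: (cvgr_gt _ yc); rewrite oppr_lt0.
have y1' : 0 < 1 + y n by lra.
rewrite -mulrA; apply/andP; split; apply: ler_wpM2l => //; last exact: le_ln1Dx.
have E : (1 + y n)^-1 = 1 - y n / (1 + y n) by field; rewrite gt_eqF.
have inv0 : 0 < (1 + y n)^-1 by rewrite invr_gt0.
rewrite -[leRHS]opprK -lnV ?posrE// lerNr.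
by rewrite {1}E; apply: le_ln1Dx; rewrite ltrNr opprK -subr_gt0 -E.
Unshelve. all: by end_near. Qed.

(** The upper bound is optimized at th0 = a / s.  In the lower bound, take
    th1 = th0 and th, th2 slightly larger, with t just below 1: the limiting
    exponents of the two correction terms are then strictly smaller than that
    of the main term, which itself tends to the optimal value. *)
Theorem log_asymptotics (c u : nat -> R) (s a : R) (A B : R -> nat -> R) :
  0 < s -> 0 < a -> (forall n, 0 < c n) -> c n @[n --> \oo] --> +oo ->
  (forall th, 0 < th -> (c n)^-1 * A th n @[n --> \oo] --> s * th ^+ 2 / 2) ->
  (forall th, 0 < th -> (c n)^-1 * B th n @[n --> \oo] --> - (a * th)) ->
  (forall th, 0 < th -> \forall n \near \oo, u n <= expR (A th n + B th n)) ->
  (forall th1 th th2 t, 0 < th1 -> th1 < th -> th < th2 -> 0 < t -> t < 1 ->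
    \forall n \near \oo, expR (t * A th n + B th n) <=
      u n + expR (A th1 n - (1 - t) * A th n + B th1 n)
          + expR (t * A th2 n + B th2 n)) ->
  (c n)^-1 * ln (u n) @[n --> \oo] --> - (a ^+ 2 / (2 * s)).
Proof.
move=> s0 a0 c0 coo Ac Bc upper lower.
pose I := a ^+ 2 / (2 * s).
pose th0 := a / s; have th00 : 0 < th0 by exact: divr_gt0.
have I0 : 0 < I by rewrite divr_gt0// ?exprn_gt0// mulr_gt0.
have key_lower : forall e, 0 < e -> e < 1 ->
    \forall n \near \oo, expR (c n * (- I - 3 * I * e)) <= u n.
  move=> e e0 e1.
  (* The relation t (1 + 2 e) = 1 makes t (th + th2) / 2 < th0 < (th0 + th) / 2,
     which is what puts the exponents E1 and E2 below E0. *)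
  pose th := (1 + e) * th0; pose th2 := (1 + 2 * e) * th0.
  pose t := (1 + 2 * e)^-1.
  have th_lt : th0 < th by rewrite /th mulrDl mul1r ltrDl mulr_gt0.
  have lt_th2 : th < th2 by rewrite /th /th2 ltr_pM2r//; lra.
  have [thp th2p] : 0 < th /\ 0 < th2 by split; apply: lt_trans th00 _ => //; exact: lt_trans lt_th2.
  have t0 : 0 < t by rewrite invr_gt0; lra.
  have t1 : t < 1 by rewrite invf_lt1//; lra.
  have tE : t * (1 + 2 * e) = 1 by rewrite mulVf// gt_eqF//; lra.
  pose E0 := t * (s * th ^+ 2 / 2) - a * th.
  pose E1 := s * th0 ^+ 2 / 2 - (1 - t) * (s * th ^+ 2 / 2) - a * th0.
  pose E2 := t * (s * th2 ^+ 2 / 2) - a * th2.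
  have c_E0 : (c n)^-1 * (t * A th n + B th n) @[n --> \oo] --> E0.
    under eq_fun do rewrite mulrDr mulrCA.
    by apply: cvgD; [apply: cvgM; [exact: cvg_cst|exact: Ac]|exact: Bc].
  have c_E1 : (c n)^-1 * (A th0 n - (1 - t) * A th n + B th0 n) @[n --> \oo] --> E1.
    under eq_fun do rewrite mulrDr mulrBr mulrCA.
    apply: cvgD; last exact: Bc.
    apply: cvgB; first exact: Ac.
    by apply: cvgM; [exact: cvg_cst|exact: Ac].
  have c_E2 : (c n)^-1 * (t * A th2 n + B th2 n) @[n --> \oo] --> E2.
    under eq_fun do rewrite mulrDr mulrCA.
    by apply: cvgD; [apply: cvgM; [exact: cvg_cst|exact: Ac]|exact: Bc].
  have sth0 : s * th0 = a by rewrite /th0 mulrC divfK// gt_eqF.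
  have IE : I = a * th0 / 2 by rewrite /I /th0; field; rewrite gt_eqF.
  have sq x : s * (x * th0) ^+ 2 / 2 = x ^+ 2 * I by rewrite IE -sth0; field.
  have lin x : a * (x * th0) = 2 * x * I by rewrite IE; field.
  have E0E : E0 = t * (1 + e) ^+ 2 * I - 2 * (1 + e) * I.
    by rewrite /E0 /th sq lin mulrA.
  have E1E : E1 = I - (1 - t) * (1 + e) ^+ 2 * I - 2 * I.
    rewrite /E1 -{1}[th0]mul1r -{2}[th0]mul1r /th !sq lin expr1n; ring.
  have E2E : E2 = (1 + 2 * e) * I - 2 * (1 + 2 * e) * I.
    rewrite /E2 /th2 sq lin expr2 !mulrA tE; ring.
  have te2 : 0 < t * e * e by rewrite !mulr_gt0.
  have E0sq : t * (1 + e) ^+ 2 = 1 + t * e * e.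
    by move: tE; rewrite expr2; lra.
  have E0lo : - I - 2 * I * e < E0.
    rewrite E0E E0sq; have := mulr_gt0 te2 I0; lra.
  have E10 : E1 < E0.
    have : 0 < e * e * I by rewrite mulr_gt0// mulr_gt0.
    have -> : E1 = - I - (1 + e) ^+ 2 * I + t * (1 + e) ^+ 2 * I by rewrite E1E; ring.
    by rewrite E0E; rewrite expr2; lra.
  have E20 : E2 < E0.
    have := mulr_gt0 te2 I0.
    by rewrite E2E E0E E0sq; lra.
  have [dl [dl0 d1 d2 d3]] : exists dl,
      [/\ 0 < dl, E1 < E0 - 2 * dl, E2 < E0 - 2 * dl & 2 * dl <= I * e].
    pose m := Num.min (Num.min (E0 - E1) (E0 - E2)) (I * e).
    have m0 : 0 < m by rewrite !lt_min !subr_gt0 E10 E20 mulr_gt0.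
    have m1 : m <= E0 - E1 by rewrite !ge_min lexx.
    have m2 : m <= E0 - E2 by rewrite !ge_min lexx orbT.
    have m3 : m <= I * e by rewrite ge_min lexx orbT.
    by exists (m / 4); split; lra.
  have low := @lower th0 th th2 t th00 th_lt lt_th2 t0 t1.
  have nE0 : \forall n \near \oo, E0 - dl < (c n)^-1 * (t * A th n + B th n).
    by apply: (cvgr_gt _ c_E0); lra.
  have nE1 : \forall n \near \oo,
      (c n)^-1 * (A th0 n - (1 - t) * A th n + B th0 n) < E0 - 2 * dl.
    exact: (cvgr_lt _ c_E1).
  have nE2 : \forall n \near \oo, (c n)^-1 * (t * A th2 n + B th2 n) < E0 - 2 * dl.
    exact: (cvgr_lt _ c_E2).
  have nc : \forall n \near \oo, 2 / dl <= c n.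
    by move/cvgryPge : coo; apply.
  near=> n; have cn0 := c0 n.
  have lown : expR (t * A th n + B th n) <= u n +
      expR (A th0 n - (1 - t) * A th n + B th0 n) + expR (t * A th2 n + B th2 n).
    by near: n.
  have cn : 2 <= c n * dl by rewrite -ler_pdivrMr//; near: n.
  (* The main term is at least 3 x and each correction at most x. *)
  set x := expR (c n * (E0 - 2 * dl)).
  have x0 : 0 < x by exact: expR_gt0.
  have x3 : 3 * x <= expR (t * A th n + B th n).
    apply: (@le_trans _ _ (expR (c n * (E0 - dl)))).
      rewrite (_ : c n * (E0 - dl) = c n * dl + c n * (E0 - 2 * dl)); last by ring.
      rewrite expRD ler_pM2r//; apply: le_trans (expR_ge1Dx _); lra.
    by rewrite ler_expR -ler_pdivlMl// ltW//; near: n.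
  have x1 : expR (A th0 n - (1 - t) * A th n + B th0 n) <= x.
    by rewrite ler_expR -ler_pdivrMl// ltW//; near: n.
  have x2 : expR (t * A th2 n + B th2 n) <= x.
    by rewrite ler_expR -ler_pdivrMl// ltW//; near: n.
  apply: (@le_trans _ _ x); last lra.
  by rewrite ler_expR ler_pM2l//; lra.
have u_gt0 : \forall n \near \oo, 0 < u n.
  have := key_lower (1 / 2) ltac:(lra) ltac:(lra).
  by apply: filterS => n; apply: lt_le_trans; exact: expR_gt0.
apply/cvgrPdist_lt => eps eps0.
pose e := Num.min (1 / 2) (eps / (6 * I)).
have e0 : 0 < e by rewrite lt_min !divr_gt0// mulr_gt0.
have e1 : e < 1.
  by rewrite gt_min; apply/orP; left; lra.
have e2 : 3 * I * e < eps.
  have : e <= eps / (6 * I) by rewrite ge_min lexx orbT.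
  rewrite ler_pdivlMr; last by rewrite mulr_gt0.
  lra.
have up_lim : (c n)^-1 * (A th0 n + B th0 n) @[n --> \oo] --> - I.
  under eq_fun do rewrite mulrDr.
  rewrite (_ : - I = s * th0 ^+ 2 / 2 - a * th0); last first.
    by rewrite /I /th0; field; rewrite gt_eqF.
  by apply: cvgD; [exact: Ac|exact: Bc].
have upn := upper _ th00.
have lown := key_lower _ e0 e1.
near=> n; have cn0 := c0 n.
have un0 : 0 < u n by near: n.
have h1 : (c n)^-1 * ln (u n) < - I + eps.
  apply: (@le_lt_trans _ _ ((c n)^-1 * (A th0 n + B th0 n))).
    rewrite ler_pM2l ?invr_gt0// -[leRHS]expRK ler_ln ?posrE ?expR_gt0//.
    by near: n.
  by near: n; apply: (cvgr_lt _ up_lim); rewrite ltrDl.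
have h2 : - I - 3 * I * e <= (c n)^-1 * ln (u n).
  rewrite ler_pdivlMl// -[leLHS]expRK ler_ln ?posrE ?expR_gt0//.
  by near: n.
rewrite -/I ltr_norml; apply/andP; split; lra.
Unshelve. all: by end_near. Qed.

End LogLimits.

(** * Moderate deviations for the record chain *)

Section Core.
Context {R : realType} (pi : nat -> R) (v : nat -> int).
Hypothesis pi_ge0 : forall k, 0 <= pi k.
Hypothesis pi_sum : (\sum_(0 <= k <oo) (pi k)%:E = 1)%E.
Hypothesis pi_mean : mean pi (fun k => k%:R%:E) = 1%E.
Variable s : R.
Hypothesis pi_var : mean pi (fun k => (k%:R * (k%:R - 1))%:E) = s%:E.
Hypothesis s_gt0 : 0 < s.

(** This is 1 / z, for z = r / phi(r) at r = 1 - h. *)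
Definition growth (h : R) : R := gen pi (1 - h) / (1 - h).

Lemma growthE h : 0 <= h < 1 ->
  growth h = 1 + h ^+ 2 * curvature pi h / (1 - h).
Proof.
move=> /andP[h0 h1]; have h01 : 0 <= h <= 1 by rewrite h0 ltW.
rewrite /growth (gen_expansion pi_ge0 pi_sum pi_mean pi_var h01).
by field; lra.
Qed.

Lemma growth_ge1 h : 0 <= h < 1 -> 1 <= growth h.
Proof.
move=> h01; rewrite growthE//; have /andP[h0 h1] := h01.
have h01' : 0 <= h <= 1 by rewrite h0 ltW.
have [_ /andP[c0 _]] := curvatureE pi_ge0 pi_var h01'.
by rewrite lerDl divr_ge0// ?mulr_ge0 ?exprn_ge0//; lra.
Qed.

Lemma le_gen h : 0 <= h < 1 -> 1 - h <= gen pi (1 - h).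
Proof.
move=> h01; have := growth_ge1 h01; have /andP[h0 h1] := h01.
by rewrite /growth ler_pdivlMr ?mul1r// subr_gt0.
Qed.

Variables (kap : R -> R) (kappa : R) (V : R -> nat * nat -> R).
Hypothesis V_transform : forall h, 0 < h -> h < 1 ->
  record_transform pi v (growth h) (1 - h * kap h) (V h).
Hypothesis V_mono : forall h h' st, 0 < h' -> h' <= h -> h < 1 ->
  growth h' <= growth h -> V h st <= V h' st.
Hypothesis kappa_gt0 : 0 < kappa.
Hypothesis kap_cvg : forall h : nat -> R, (forall n, 0 <= h n) ->
  h n @[n --> \oo] --> 0 -> kap (h n) @[n --> \oo] --> kappa.

Variables (c : nat -> R) (x : R).
Hypothesis c_gt0 : forall n, 0 < c n.
Hypothesis c_oo : c n @[n --> \oo] --> +oo.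
Hypothesis c_o : c =o_\oo (fun n : nat => n%:R : R).
Hypothesis x_gt0 : 0 < x.

Let k n : nat := `|Num.ceil (x * n%:R `^ 2^-1 * c n `^ 2^-1)|%N.
Let eps n : R := Num.sqrt (c n / n%:R).
Let A th n : R := n%:R * ln (growth (th * eps n)).
Let B th n : R := (k n)%:R * ln (1 - th * eps n * kap (th * eps n)).

Let eps_ge0 n : 0 <= eps n. Proof. exact: sqrtr_ge0. Qed.

Let eps_sqr n : (0 < n)%N -> n%:R * eps n ^+ 2 = c n.
Proof.
move=> n0; rewrite sqr_sqrtr; last by rewrite divr_ge0// ltW.
by rewrite mulrC divfK// pnatr_eq0 -lt0n.
Qed.

(* The scale sqrt(c n / n) vanishes because c n is small compared with n. *)
Let eps_cvg : eps n @[n --> \oo] --> 0.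
Proof.
apply/cvgrPdist_lt => e e0.
have e20 : 0 < (e / 2) ^+ 2 by rewrite exprn_gt0// divr_gt0.
have /eqoP/(_ _ e20) := c_o.
apply: filterS2 (nbhs_infty_gt 0) => n n0 cn.
rewrite (ger0_norm (ltW (c_gt0 n))) ger0_norm// in cn.
rewrite sub0r normrN ger0_norm//.
have n0' : 0 < n%:R :> R by rewrite ltr0n.
apply: (@le_lt_trans _ _ (e / 2)); last lra.
rewrite -[leRHS]ger0_norm; last by rewrite ltW// divr_gt0.
by rewrite -sqrtr_sqr; apply: ler_wsqrtr; rewrite ler_pdivrMr.
Qed.

Let small th (e : R) : 0 < th -> 0 < e ->
  \forall n \near \oo, 0 < th * eps n < e.
Proof.
move=> th0 e0.
have et0 : 0 < e / th by rewrite divr_gt0.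
have n1 := cvgr_lt _ eps_cvg _ et0.
near=> n; have n0 : (0 < n)%N by near: n; exact: nbhs_infty_gt.
apply/andP; split.
  by rewrite mulr_gt0// sqrtr_gt0 divr_gt0// ltr0n.
by rewrite mulrC -ltr_pdivlMr//; near: n; exact: n1.
Unshelve. all: by end_near. Qed.

Let heps_cvg th : 0 < th -> th * eps n @[n --> \oo] --> 0.
Proof.
by move=> th0; rewrite -(mulr0 th); apply: cvgM => //; exact: cvg_cst.
Qed.

Let k_cvg : (c n)^-1 * ((k n)%:R * eps n) @[n --> \oo] --> x.
Proof.
have up : x + eps n @[n --> \oo] --> x.
  by rewrite -[X in _ --> X]addr0; apply: cvgD => //; exact: cvg_cst.
apply: (squeeze_cvgr _ (cvg_cst x) up); near=> n.
have n0 : (0 < n)%N by near: n; exact: nbhs_infty_gt.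
have c1 : 1 <= c n by near: n; move/cvgryPge : c_oo; apply.
have cn0 := c_gt0 n.
set y := x * n%:R `^ 2^-1 * c n `^ 2^-1.
have y0 : 0 <= y by rewrite !mulr_ge0 ?powR_ge0// ltW.
have kE : (k n)%:R = (Num.ceil y)%:~R :> R.
  by rewrite /k -/y natr_absz ger0_norm// ceil_ge0 (lt_le_trans _ y0).
have k1 : y <= (k n)%:R by rewrite kE; exact: ceil_ge.
have k2 : (k n)%:R <= y + 1.
  by rewrite kE; have := ceilB1_lt y; rewrite intrD mulrN1z; lra.
have yE : y * eps n = x * c n.
  rewrite /y /eps !powR12_sqrt ?(ltW cn0)// sqrtrM ?(ltW cn0)// sqrtrV//.
  transitivity (x * Num.sqrt (c n) ^+ 2); last by rewrite sqr_sqrtr// ltW.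
  by field; rewrite gt_eqF// sqrtr_gt0 ltr0n.
apply/andP; split.
  by rewrite ler_pdivlMl// mulrC -yE ler_wpM2r.
rewrite ler_pdivrMl// mulrDr (mulrC _ x) -yE.
apply: (@le_trans _ _ ((y + 1) * eps n)); first exact: ler_wpM2r.
by rewrite mulrDl mul1r lerD2l ler_peMl.
Unshelve. all: by end_near. Qed.

Let cvg_A th : 0 < th -> (c n)^-1 * A th n @[n --> \oo] --> s * th ^+ 2 / 2.
Proof.
move=> th0; pose h n := th * eps n.
have hc : h n @[n --> \oo] --> 0 by exact: heps_cvg.
have h0 n : 0 <= h n by rewrite mulr_ge0// ltW.
have curv : curvature pi (h n) @[n --> \oo] --> s / 2 by exact: curvature_cvg.
have inv1 : (1 - h n)^-1 @[n --> \oo] --> (1 : R).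
  have : (1 - h n)^-1 @[n --> \oo] --> ((1 - 0)^-1 : R).
    apply: cvgV; first by rewrite subr0.
    by apply: cvgB => //; exact: cvg_cst.
  by rewrite subr0 invr1.
have ratio : curvature pi (h n) * (1 - h n)^-1 @[n --> \oo] --> s / 2.
  by rewrite -[X in _ --> X]mulr1; exact: cvgM.
pose y n := h n ^+ 2 * (curvature pi (h n) * (1 - h n)^-1).
have yc : y n @[n --> \oo] --> 0.
  rewrite -[X in _ --> X](mul0r (s / 2)); apply: cvgM => //.
  have : h n * h n @[n --> \oo] --> (0 * 0 : R) by exact: cvgM.
  by rewrite mulr0; under eq_fun do rewrite -expr2.
have ayc : (c n)^-1 * n%:R * y n @[n --> \oo] --> s * th ^+ 2 / 2.
  have : th ^+ 2 * (curvature pi (h n) * (1 - h n)^-1) @[n --> \oo] --> th ^+ 2 * (s / 2).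
    by apply: cvgM => //; exact: cvg_cst.
  rewrite (_ : s * th ^+ 2 / 2 = th ^+ 2 * (s / 2)); last by ring.
  apply: cvg_trans; apply: near_eq_cvg; near=> n.
  have n0 : (0 < n)%N by near: n; exact: nbhs_infty_gt.
  rewrite /y /h exprMn; have := eps_sqr n0 => E.
  have -> : (c n)^-1 * n%:R * (th ^+ 2 * eps n ^+ 2 * (curvature pi (th * eps n) * (1 - th * eps n)^-1)) =
      (c n)^-1 * (n%:R * eps n ^+ 2) * (th ^+ 2 * (curvature pi (th * eps n) * (1 - th * eps n)^-1)) by ring.
  by rewrite E mulVf ?mul1r// gt_eqF.
have a0 n : 0 <= (c n)^-1 * n%:R by rewrite mulr_ge0// invr_ge0 ltW.
have := cvg_mul_ln1D a0 yc ayc.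
apply: cvg_trans; apply: near_eq_cvg; near=> n.
have /andP[h0' h1'] : 0 < th * eps n < 1 by near: n; exact: small.
have h01 : 0 <= th * eps n < 1 by rewrite ltW.
by rewrite /A growthE// /y /h !mulrA.
Unshelve. all: by end_near. Qed.

Let cvg_B th : 0 < th -> (c n)^-1 * B th n @[n --> \oo] --> - (kappa * x * th).
Proof.
move=> th0; pose h n := th * eps n.
have hc : h n @[n --> \oo] --> 0 by exact: heps_cvg.
have h0 n : 0 <= h n by rewrite mulr_ge0// ltW.
have kc : kap (h n) @[n --> \oo] --> kappa by exact: kap_cvg.
have yc : - (h n * kap (h n)) @[n --> \oo] --> 0.
  have : - (h n * kap (h n)) @[n --> \oo] --> (- (0 * kappa) : R).
    by apply: cvgN; exact: cvgM.
  by rewrite mul0r oppr0.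
have ayc : (c n)^-1 * (k n)%:R * - (h n * kap (h n)) @[n --> \oo] --> - (kappa * x * th).
  under eq_fun => n.
    have -> : (c n)^-1 * (k n)%:R * - (h n * kap (h n)) =
      - ((c n)^-1 * ((k n)%:R * eps n) * (th * kap (h n))) by rewrite /h; ring.
    over.
  rewrite (_ : kappa * x * th = x * (th * kappa)); last by ring.
  by apply: cvgN; apply: cvgM => //; apply: cvgM => //; exact: cvg_cst.
have a0 n : 0 <= (c n)^-1 * (k n)%:R by rewrite mulr_ge0// invr_ge0 ltW.
have := cvg_mul_ln1D a0 yc ayc.
by under eq_fun do rewrite -mulrA.
Qed.

Notation hit_k n := (fine (hit record_step no_record_left pi v n (0%N, k n))).

Let F_gt0 th : 0 < th -> \forall n \near \oo, 0 < 1 - th * eps n * kap (th * eps n).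
Proof.
move=> th0; have hc := heps_cvg th0.
have : 1 - th * eps n * kap (th * eps n) @[n --> \oo] --> (1 - 0 * kappa : R).
  apply: cvgB; first exact: cvg_cst.
  by apply: cvgM => //; apply: kap_cvg => // n; rewrite mulr_ge0// ltW.
by rewrite mul0r subr0 => /cvgr_gt; apply.
Qed.

Let growth_gt0 h : 0 < h -> h < 1 -> 0 < growth h.
Proof. by move=> h0 h1; apply: lt_le_trans ltr01 _; rewrite growth_ge1// h1 ltW. Qed.

Let start_expR th n : 0 < th * eps n < 1 ->
  0 < 1 - th * eps n * kap (th * eps n) ->
  V (th * eps n) (0%N, k n) = expR (B th n).
Proof.
move=> /andP[h0 h1] F0; rewrite (transform_start (V_transform h0 h1)).
by rewrite /B expRM_natl lnK.
Qed.

Let growth_expR th n : 0 < th * eps n < 1 ->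
  growth (th * eps n) ^+ n = expR (A th n).
Proof. by move=> /andP[h0 h1]; rewrite /A expRM_natl lnK// posrE growth_gt0. Qed.

Let hit_le th : 0 < th -> \forall n \near \oo, hit_k n <= expR (A th n + B th n).
Proof.
move=> th0; have Fn := F_gt0 th0; have hn := small th0 ltr01.
near=> n; have F0 : 0 < 1 - th * eps n * kap (th * eps n) by near: n.
have h01 : 0 < th * eps n < 1 by near: n.
have /andP[h0 h1] := h01.
rewrite expRD -growth_expR// -start_expR// -lee_fin fineK ?hit_fin_num//.
apply: hit_upper (V_transform h0 h1) => //.
by rewrite growth_ge1// h1 ltW.
Unshelve. all: by end_near. Qed.

Let A_lt th th' : 0 < th -> th < th' -> \forall n \near \oo, A th n < A th' n.
Proof.
move=> th0 thth'; have th'0 := lt_trans th0 thth'.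
have sq : s * th ^+ 2 / 2 < s * th' ^+ 2 / 2.
  by rewrite ltr_pM2r// ltr_pM2l// !expr2; apply: ltr_pM => //; exact: ltW.
pose mid := (s * th ^+ 2 / 2 + s * th' ^+ 2 / 2) / 2.
have n1 : \forall n \near \oo, (c n)^-1 * A th n < mid.
  by apply: (cvgr_lt _ (cvg_A th0)); rewrite /mid; lra.
have n2 : \forall n \near \oo, mid < (c n)^-1 * A th' n.
  by apply: (cvgr_gt _ (cvg_A th'0)); rewrite /mid; lra.
near=> n; have ci : 0 < (c n)^-1 by rewrite invr_gt0.
by rewrite -(ltr_pM2l ci); apply: (@lt_trans _ _ mid); near: n.
Unshelve. all: by end_near. Qed.

Let hit_ge th1 th th2 t : 0 < th1 -> th1 < th -> th < th2 -> 0 < t -> t < 1 ->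
  \forall n \near \oo, expR (t * A th n + B th n) <=
    hit_k n + expR (A th1 n - (1 - t) * A th n + B th1 n)
            + expR (t * A th2 n + B th2 n).
Proof.
move=> th10 lt1 lt2 t0 t1.
have th0 := lt_trans th10 lt1; have th20 := lt_trans th0 lt2.
have F1n := F_gt0 th10; have Fn := F_gt0 th0; have F2n := F_gt0 th20.
have h1n := small th10 ltr01; have hn := small th0 ltr01.
have h2n := small th20 ltr01.
have A1n := A_lt th10 lt1; have A2n := A_lt th0 lt2.
near=> n; have n0 : (0 < n)%N by near: n; exact: nbhs_infty_gt.
have F1 : 0 < 1 - th1 * eps n * kap (th1 * eps n) by near: n.
have F : 0 < 1 - th * eps n * kap (th * eps n) by near: n.
have F2 : 0 < 1 - th2 * eps n * kap (th2 * eps n) by near: n.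
have h1 : 0 < th1 * eps n < 1 by near: n.
have h : 0 < th * eps n < 1 by near: n.
have h2 : 0 < th2 * eps n < 1 by near: n.
have A1 : A th1 n < A th n by near: n.
have A2 : A th n < A th2 n by near: n.
have nR : 0 < n%:R :> R by rewrite ltr0n.
have /andP[h10 h11] := h1; have /andP[h00 h01] := h; have /andP[h20 h21] := h2.
have g1 := growth_gt0 h10 h11; have g0 := growth_gt0 h00 h01.
have g2 := growth_gt0 h20 h21.
set l1 := ln (growth (th1 * eps n)); set l := ln (growth (th * eps n)).
set l2 := ln (growth (th2 * eps n)).
have AE : A th n = n%:R * l by []. have AE1 : A th1 n = n%:R * l1 by [].
have AE2 : A th2 n = n%:R * l2 by [].
have l_ge0 : 0 <= l by rewrite ln_ge0// growth_ge1// h01 ltW.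
have ll1 : l1 < l by rewrite -(ltr_pM2l nR).
have ll2 : l < l2 by rewrite -(ltr_pM2l nR).
have grE : growth (th * eps n) = expR l by rewrite lnK.
have gr1E : growth (th1 * eps n) = expR l1 by rewrite lnK.
have gr2E : growth (th2 * eps n) = expR l2 by rewrite lnK.
(* a and b normalize the tilts at time (1 - t) n: if m <= (1 - t) n the left
   side of ab is at most 1, otherwise the larger rate l2 dominates. *)
pose a := expR (- ((1 - t) * A th n)); pose b := expR (- ((1 - t) * A th2 n)).
have Vle st : V (th * eps n) st <= V (th1 * eps n) st.
  apply: V_mono => //; first by rewrite ler_wpM2r// ltW.
  by rewrite grE gr1E ler_expR ltW.
have ab m : a * growth (th * eps n) ^+ m <= 1 + b * growth (th2 * eps n) ^+ m.
  rewrite /a /b grE gr2E -!expRM_natl -!expRD AE AE2.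
  have -> : - ((1 - t) * (n%:R * l)) + m%:R * l = (m%:R - (1 - t) * n%:R) * l by ring.
  have -> : - ((1 - t) * (n%:R * l2)) + m%:R * l2 = (m%:R - (1 - t) * n%:R) * l2 by ring.
  case: (lerP m%:R ((1 - t) * n%:R)) => [le|lt].
    apply: (@le_trans _ _ 1); last by rewrite lerDl expR_ge0.
    by rewrite -[leRHS]expR0 ler_expR mulr_le0_ge0// subr_le0.
  apply: (@le_trans _ _ (expR ((m%:R - (1 - t) * n%:R) * l2))); last by rewrite lerDr.
  by rewrite ler_expR ler_pM2l ?subr_gt0// ltW.
have := @hit_lower R pi v pi_ge0 pi_sum _ _ _ _ _ _ _ _ _ a b n (0%N, k n)
  (V_transform h00 h01) (V_transform h10 h11) (V_transform h20 h21)
  (ltW g0) (ltW g1) (ltW g2) (expR_ge0 _) (expR_ge0 _) Vle ab.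
rewrite -(fineK (hit_fin_num v pi_ge0 pi_sum n (0%N, k n))) -!EFinD lee_fin.
rewrite !start_expR// !growth_expR// /a /b -!expRD.
have -> : - ((1 - t) * A th n) + A th n + B th n = t * A th n + B th n by ring.
have -> : - ((1 - t) * A th n) + A th1 n + B th1 n = A th1 n - (1 - t) * A th n + B th1 n by ring.
by have -> : - ((1 - t) * A th2 n) + A th2 n + B th2 n = t * A th2 n + B th2 n by ring.
Unshelve. all: by end_near. Qed.

(** The walk enters only through kappa, the rate at which the transform of the
    first record time leaves 1, and through the variance s. *)
Theorem hit_moderate_deviations :
  (c n)^-1 * ln (hit_k n) @[n --> \oo] --> - ((kappa * x) ^+ 2 / (2 * s)).
Proof.
apply: (@log_asymptotics _ c (fun n => hit_k n) s (kappa * x) A B) => //.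
by rewrite mulr_gt0.
Qed.

End Core.

(** * The two record transforms near r = 1 *)

Section GenLimit.
Context {R : realType} (pi : nat -> R).
Hypothesis pi_ge0 : forall k, 0 <= pi k.
Hypothesis pi_sum : (\sum_(0 <= k <oo) (pi k)%:E = 1)%E.
Hypothesis pi_mean : mean pi (fun k => k%:R%:E) = 1%E.
Variable s : R.
Hypothesis pi_var : mean pi (fun k => (k%:R * (k%:R - 1))%:E) = s%:E.

Lemma gen_cvg1 (h : nat -> R) : (forall n, 0 <= h n) ->
  h n @[n --> \oo] --> 0 -> gen pi (1 - h n) @[n --> \oo] --> (1 : R).
Proof.
move=> h0 hc.
have lim : 1 - h n + h n * h n * curvature pi (h n) @[n --> \oo] -->
    (1 - 0 + 0 * 0 * (s / 2) : R).
  apply: cvgD; first by apply: cvgB => //; exact: cvg_cst.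
  by apply: cvgM; [exact: cvgM|exact: curvature_cvg].
rewrite !mul0r subr0 addr0 in lim; apply: cvg_trans lim.
apply: near_eq_cvg; near=> n.
have h1 : 0 <= h n <= 1.
  by rewrite h0 ltW//; near: n; exact: (cvgr_lt _ hc _ ltr01).
by rewrite (gen_expansion pi_ge0 pi_sum pi_mean pi_var h1) expr2.
Unshelve. all: by end_near. Qed.

Lemma right_rate_cvg (h : nat -> R) : (forall n, 0 <= h n) ->
  h n @[n --> \oo] --> 0 ->
  pi 0%N / gen pi (1 - h n) @[n --> \oo] --> pi 0%N.
Proof.
move=> h0 hc; have : pi 0%N / gen pi (1 - h n) @[n --> \oo] --> pi 0%N / 1.
  apply: cvgM; first exact: cvg_cst.
  by apply: cvgV; [rewrite oner_neq0|exact: gen_cvg1].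
by rewrite divr1.
Qed.

Lemma left_rate_cvg (h : nat -> R) : (forall n, 0 <= h n) ->
  h n @[n --> \oo] --> 0 ->
  curvature pi (h n) / gen pi (1 - h n) @[n --> \oo] --> s / 2.
Proof.
move=> h0 hc.
have : curvature pi (h n) / gen pi (1 - h n) @[n --> \oo] --> s / 2 / 1.
  apply: cvgM; first exact: curvature_cvg.
  by apply: cvgV; [rewrite oner_neq0|exact: gen_cvg1].
by rewrite divr1.
Qed.

Lemma right_transform_rate h : 0 < h -> h < 1 ->
  record_transform pi (fun k => 1 - k%:Z) (growth pi h)
    (1 - h * (pi 0%N / gen pi (1 - h)))
    (right_transform (1 - h * (pi 0%N / gen pi (1 - h))) (1 - h)).
Proof.
move=> h0 h1; have h01 : 0 <= h < 1 by rewrite ltW.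
have rg := le_gen pi_ge0 pi_sum pi_mean pi_var h01.
have r01 : 0 < 1 - h < 1 by apply/andP; split; lra.
by have := right_transformP pi_ge0 pi_sum r01 rg; rewrite subKr.
Qed.

Lemma right_rate_mono h h' st : 0 < h' -> h' <= h -> h < 1 ->
  growth pi h' <= growth pi h ->
  right_transform (1 - h * (pi 0%N / gen pi (1 - h))) (1 - h) st <=
  right_transform (1 - h' * (pi 0%N / gen pi (1 - h'))) (1 - h') st.
Proof.
move=> h'0 hh' h1 gg.
have h01 : 0 <= h < 1 by rewrite h1 (le_trans (ltW h'0)).
have h'01 : 0 <= h' < 1 by rewrite (ltW h'0) (le_lt_trans hh').
have rg := le_gen pi_ge0 pi_sum pi_mean pi_var h01.
have r'g := le_gen pi_ge0 pi_sum pi_mean pi_var h'01.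
have := @right_transform_mono _ pi pi_ge0 pi_sum (1 - h) (1 - h').
by rewrite !subKr; apply=> //; lra.
Qed.

Lemma left_transform_rate h : 0 < h -> h < 1 ->
  record_transform pi (fun k => k%:Z - 1) (growth pi h)
    (1 - h * (curvature pi h / gen pi (1 - h)))
    (left_transform pi ((1 - h) / gen pi (1 - h))).
Proof.
move=> h0 h1; have h01 : 0 <= h < 1 by rewrite ltW.
have rg := le_gen pi_ge0 pi_sum pi_mean pi_var h01.
have r01 : 0 < 1 - h < 1 by apply/andP; split; lra.
have g0 : 0 < gen pi (1 - h) by apply: lt_le_trans rg; lra.
have := left_transformP pi_ge0 pi_sum r01 rg; rewrite subKr.
rewrite (_ : (1 - (1 - h) / gen pi (1 - h)) / h =
  h * (curvature pi h / gen pi (1 - h)))//.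
have h01' : 0 <= h <= 1 by rewrite !ltW.
have E := gen_expansion pi_ge0 pi_sum pi_mean pi_var h01'.
have -> : curvature pi h = (gen pi (1 - h) - (1 - h)) / h ^+ 2.
  by rewrite E; field; rewrite gt_eqF.
by field; rewrite !gt_eqF.
Qed.

Lemma left_rate_mono h h' st : 0 < h' -> h' <= h -> h < 1 ->
  growth pi h' <= growth pi h ->
  left_transform pi ((1 - h) / gen pi (1 - h)) st <=
  left_transform pi ((1 - h') / gen pi (1 - h')) st.
Proof.
move=> h'0 hh' h1 gg.
have h01 : 0 <= h < 1 by rewrite h1 (le_trans (ltW h'0)).
have h'01 : 0 <= h' < 1 by rewrite (ltW h'0) (le_lt_trans hh').
have zE x : (1 - x) / gen pi (1 - x) = (growth pi x)^-1 by rewrite /growth invf_div.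
have gr := growth_ge1 pi_ge0 pi_sum pi_mean pi_var h01.
have gr' := growth_ge1 pi_ge0 pi_sum pi_mean pi_var h'01.
have g0 := lt_le_trans ltr01 gr; have g'0 := lt_le_trans ltr01 gr'.
apply: left_transform_mono => //; rewrite !zE.
- by rewrite invr_ge0 ltW.
- by rewrite lef_pV2 ?posrE.
- by rewrite invf_le1.
Qed.

End GenLimit.

Section Offspring.
Context {R : realType} (q : R) (p : nat -> R).

Definition offspring (k : nat) : R := if k is m.+1 then p m else q.

Hypothesis hphi : phi_coefficients q p.
Hypothesis hd1 : phi_d1 p = 1%E.
Hypothesis hd2 : (phi_d2 p < +oo)%E.

Lemma offspring_ge0 k : 0 <= offspring k.
Proof. by case: hphi => q0 p0 _; case: k => [|k] /=; rewrite ?p0// ltW. Qed.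

Lemma offspring_mean (f : nat -> R) : (forall k, 0 <= f k) ->
  mean offspring (fun k => (f k)%:E) =
  ((q * f 0%N)%:E + \sum_(0 <= k <oo) (f k.+1 * p k)%:E)%E.
Proof.
move=> f0; rewrite mean_recl => [||k]; last 2 first.
- exact: offspring_ge0.
- by rewrite lee_fin.
by rewrite -EFinM; congr (_ + _)%E; apply: eq_eseriesr => k _; rewrite -EFinM mulrC.
Qed.

Lemma offspring_sum : (\sum_(0 <= k <oo) (offspring k)%:E = 1)%E.
Proof.
case: hphi => _ _ <-; transitivity (mean offspring (fun=> 1%:E)).
  by apply: eq_eseriesr => k _; rewrite mule1.
rewrite offspring_mean// mulr1; congr (_ + _)%E.
by apply: eq_eseriesr => k _; rewrite mul1r.
Qed.

Lemma offspring_critical : mean offspring (fun k => k%:R%:E) = 1%E.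
Proof. by rewrite offspring_mean// mulr0 add0e -[RHS]hd1. Qed.

Lemma phi_d2_fin : phi_d2 p = (fine (phi_d2 p))%:E.
Proof.
rewrite fineK// ge0_fin_numE//; apply: nneseries_ge0 => k _ _.
by case: hphi => _ p0 _; rewrite lee_fin !mulr_ge0.
Qed.

Lemma offspring_variance :
  mean offspring (fun k => (k%:R * (k%:R - 1))%:E) = (fine (phi_d2 p))%:E.
Proof.
rewrite offspring_mean => [|k]; last exact: choose2_ge0.
rewrite mul0r mulr0 add0e -phi_d2_fin; apply: eq_eseriesr => k _.
by rewrite -natr1 addrK [(_ + 1) * _]mulrC.
Qed.

(** Criticality excludes a degenerate law: n + 1 <= n (n + 1) + 1 gives
    1 = phi'(1) <= phi''(1) + (1 - q), so the variance is at least q. *)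
Lemma phi_d2_gt0 : 0 < fine (phi_d2 p).
Proof.
case: hphi => q0 p0 sum1; apply: (lt_le_trans q0).
have [t tE] : exists t, (\sum_(0 <= n <oo) (p n)%:E = t%:E)%E.
  have : (0 <= \sum_(0 <= n <oo) (p n)%:E)%E.
    by apply: nneseries_ge0 => k _ _; rewrite lee_fin.
  by move: sum1; case: (\sum_(0 <= n <oo) _)%E => // t _ _; exists t.
have qt : q + t = 1 by move: sum1; rewrite tE -EFinD => -[].
have : (phi_d1 p <= phi_d2 p + \sum_(0 <= n <oo) (p n)%:E)%E.
  rewrite /phi_d2 -nneseriesD => [||k _ _]; last 2 first.
  - by move=> k _ _; rewrite lee_fin !mulr_ge0.
  - by rewrite lee_fin.
  apply: lee_nneseries => k _; first by move=> _; rewrite lee_fin mulr_ge0.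
  rewrite -EFinD lee_fin -[X in _ + X]mul1r -mulrDl ler_wpM2r//.
  case: k => [|k]; first by rewrite mul0r add0r.
  by rewrite ler_wpDr// ler_peMl// ler1n.
by rewrite hd1 tE phi_d2_fin -EFinD lee_fin; lra.
Qed.

End Offspring.

(** * Moderate deviations of the weak record number *)

Theorem corollary2p1 (R : realType) (d : measure_display)
    (Omega : measurableType d) (P : probability Omega R)
    (X : nat -> {RV P >-> int}) (hX : iid X)
    (q : R) (p : nat -> R) (hphi : phi_coefficients q p)
    (hd1 : phi_d1 p = 1%E) (hd2 : (phi_d2 p < +oo)%E)
    (c : nat -> R) (hc0 : forall n, 0 < c n)
    (hcoo : c n @[n --> \oo] --> +oo)
    (hco : c =o_\oo (fun n : nat => n%:R : R)) :
  let sigma : R := Num.sqrt (fine (phi_d2 p)) in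
  let prob (x : R) (n : nat) : R :=
    fine (P [set w | ((x * n%:R `^ 2^-1 * c n `^ 2^-1)%:E
                        <= weak_record_number R X n w)%E]) in
  (right_continuous_walk q p X ->
     forall x : R, 0 < x ->
       (c n)^-1 * ln (prob x n) @[n --> \oo] -->
         - (q ^+ 2 * x ^+ 2 / (2 * sigma ^+ 2))) /\
  (left_continuous_walk q p X ->
     forall x : R, 0 < x ->
       (c n)^-1 * ln (prob x n) @[n --> \oo] -->
         - (sigma ^+ 2 / 8 * x ^+ 2)).
Proof.
move=> sigma prob.
have s0 := phi_d2_gt0 hphi hd1 hd2.
have pi0 := offspring_ge0 hphi; have pi1 := offspring_sum hphi.
have pim := offspring_critical hphi hd1.
have piv := offspring_variance hphi hd2.
have q0 : 0 < q by case: hphi.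
have sigma2 : sigma ^+ 2 = fine (phi_d2 p) by rewrite sqr_sqrtr// ltW.
have probE (v : nat -> int) (x : R) n : injective v -> 0 < x ->
    (forall i k, P (X i @^-1` [set v k]) = (offspring q p k)%:E) ->
    prob x n = fine (hit record_step no_record_left (offspring q p) v n
      (0%N, `|Num.ceil (x * n%:R `^ 2^-1 * c n `^ 2^-1)|%N)).
  move=> v_inj x0 law; rewrite /prob record_eventE; last first.
    by rewrite !mulr_ge0 ?powR_ge0// ltW.
  by rewrite (prob_state (proj1 hX) v_inj law pi0 pi1).
have mulr_var_neq0 : fine (phi_d2 p) != 0 by rewrite gt_eqF.
split=> law x x0.
- have v_inj : injective (fun k : nat => 1 - k%:Z : int) by move=> i j; lia.
  have lawv i k : P (X i @^-1` [set (1 - k%:Z : int)]) = (offspring q p k)%:E.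
    have [law1 lawN] := law i; case: k => [|k] /=; first by rewrite subr0.
    by rewrite -lawN (_ : 1 - k.+1%:Z = - k%:Z)//; lia.
  under eq_fun do rewrite (probE _ _ _ v_inj x0 lawv).
  rewrite sigma2 -exprMn.
  apply: (@hit_moderate_deviations _ _ _ pi0 pi1 pim _ piv s0
    (fun h => offspring q p 0 / gen (offspring q p) (1 - h)) q
    (fun h => right_transform
       (1 - h * (offspring q p 0 / gen (offspring q p) (1 - h))) (1 - h))) => //.
  + exact: (right_transform_rate pi0 pi1 pim piv).
  + by move=> h h' st; exact: (right_rate_mono pi0 pi1 pim piv).
  + exact: (right_rate_cvg pi0 pi1 pim piv).
- have v_inj : injective (fun k : nat => k%:Z - 1 : int) by move=> i j; lia.
  have lawv i k : P (X i @^-1` [set (k%:Z - 1 : int)]) = (offspring q p k)%:E.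
    have [law1 lawN] := law i; case: k => [|k] /=; first by rewrite sub0r.
    by rewrite -lawN (_ : k.+1%:Z - 1 = k%:Z)//; lia.
  under eq_fun do rewrite (probE _ _ _ v_inj x0 lawv).
  rewrite sigma2 (_ : fine (phi_d2 p) / 8 * x ^+ 2 =
    (fine (phi_d2 p) / 2 * x) ^+ 2 / (2 * fine (phi_d2 p))); last by field.
  apply: (@hit_moderate_deviations _ _ _ pi0 pi1 pim _ piv s0
    (fun h => curvature (offspring q p) h / gen (offspring q p) (1 - h))
    (fine (phi_d2 p) / 2)
    (fun h => left_transform (offspring q p)
       ((1 - h) / gen (offspring q p) (1 - h)))) => //.
  + exact: (left_transform_rate pi0 pi1 pim piv).
  + by move=> h h' st; exact: (left_rate_mono pi0 pi1 pim piv).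
  + by rewrite divr_gt0.
  + exact: (left_rate_cvg pi0 pi1 pim piv).
Qed.
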